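(* Let $p_1,p_2,p_3\ge 2$ be integers, and let $Q$, $\delta=(1,\dots,1)$, $I$, $\mathscr{R}$, $G=\mathrm{GL}$, $\vartheta_0$ and $\Delta$ be as defined in the context. Let $$\pi\colon \operatorname{Spec}\mathscr{R}^G=\mathrm{Rep}(\mathbb{C}Q/I,\delta)/\!\!/\mathrm{GL}\longrightarrow \Delta$$ be the morphism defined in the context, and let $$\phi\colon \mathrm{Rep}(\mathbb{C}Q/I,\delta)/\!\!/_{\vartheta_0}\mathrm{GL}\longrightarrow \operatorname{Spec}\mathscr{R}^G\xrightarrow{\ \pi\ }\Delta$$ be the composition of the canonical morphism from the GIT quotient to the affine quotient with $\pi$. Then this diagram is a simultaneous resolution of singularities in the sense that the morphism $\phi$ is smooth and the morphism $\pi$ is flat.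
   Context: Everything is over $\mathbb{C}$. Products of arrows: $ab$ means $a$ followed by $b$; $t(a)$, $h(a)$ are the tail and head of an arrow $a$. Quiver $Q$: it has a top vertex $0$, a bottom vertex $b_0$, and three arms $i=1,2,3$ joining them; arm $i$ has $p_i-1$ interior vertices $x_{i,1},\dots,x_{i,p_i-1}$ listed from top to bottom; set $x_{i,0}=0$ and $x_{i,p_i}=b_0$. For each $i\in\{1,2,3\}$ and $1\le j\le p_i$ there is a downward arrow $d_{ij}\colon x_{i,j-1}\to x_{i,j}$ and an upward arrow $u_{ij}\colon x_{i,j}\to x_{i,j-1}$. Put $D_i=d_{i1}d_{i2}\cdots d_{ip_i}$ and $U_i=u_{ip_i}\cdots u_{i2}u_{i1}$. Let $\delta=(1,\dots,1)$ be the dimension vector with all entries $1$. The representation variety $\mathrm{Rep}(\mathbb{C}Q,\delta)$ is the affine space whose coordinates are the arrows $d_{ij},u_{ij}$ (same notation for an arrow and its coordinate function). Set $I=\langle D_1-D_2+D_3\rangle$ and $\mathscr{R}=\mathbb{C}[\mathrm{Rep}(\mathbb{C}Q,\delta)]/I$, the coordinate ring of $\mathrm{Rep}(\mathbb{C}Q/I,\delta)$. The group $G=\mathrm{GL}=\prod_{q\in Q_0}\mathbb{C}^*$ ($Q_0$ the vertex set) acts by $\mu\cdot p=\mu_{t(p)}^{-1}\,p\,\mu_{h(p)}$ on arrow coordinates $p$. Stability: $\vartheta_0=(-(m_1+m_2+m_3+1),1,\dots,1)$ with $m_i=p_i-1$, the first entry being at vertex $0$. A representation of dimension vector $\delta$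 is $\vartheta_0$-stable if and only if for every vertex there is a nonzero path from vertex $0$ to that vertex (for this $\vartheta_0$, semistable equals stable). $/\!\!/_{\vartheta_0}$ denotes the corresponding GIT quotient (the geometric quotient by $G$ of the $\vartheta_0$-stable locus), and $/\!\!/$ the affine quotient, i.e. $\operatorname{Spec}$ of the invariant ring. Let $\Delta$ be the set of $\boldsymbol\gamma=(\gamma_{11},\dots,\gamma_{1,p_1-1},\gamma_{21},\dots,\gamma_{2,p_2-1},\gamma_{31},\dots,\gamma_{3,p_3-1},A,B,a,b)\in\mathbb{C}^{p_1+p_2+p_3+1}$ with $$\sum_{i=1}^{p_1-1}\gamma_{1i}-\sum_{i=1}^{p_2-1}\gamma_{2i}+A+a=0,\qquad \sum_{i=1}^{p_3-1}\gamma_{3i}-\sum_{i=1}^{p_2-1}\gamma_{2i}+B+b=0,$$ regarded as an affine space. The invariant ring $\mathscr{R}^G$ is generated by $\mathsf{w}_1=D_1U_2+I$, $\mathsf{w}_2=D_2U_1+I$, $\mathsf{w}_3=-D_2U_3+I$ and $\mathsf{v}_{i,j}=d_{ij}u_{ij}+I$ for $i=1,2,3$, $1\le j\le p_i$. The morphism $\pi$ sends the point of $\operatorname{Spec}\mathscr{R}^G$ at which $\mathsf{w}_i$ takes value $\beta_i$ and $\mathsf{v}_{i,j}$ takes value $\alpha_{i,j}$ to the point $\boldsymbol\gamma\in\Delta$ with $$\gamma_{ij}=\alpha_{i,j}-\alpha_{i,j+1}\ (1\le j\le p_i-1),\quad a=\alpha_{2,1}-\alpha_{1,1},\quad b=\alpha_{2,1}-\alpha_{3,1},\quad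 A=\alpha_{1,p_1}-\alpha_{2,p_2},\quad B=\alpha_{3,p_3}-\alpha_{2,p_2}.$$ *)

(* Defs.v *)
From HB Require Import structures.
From mathcomp Require Import all_boot all_order all_algebra.
From mathcomp Require Import generic_quotient ring_quotient.
From mathcomp Require Import boolp reals.
From mathcomp Require Import mpoly complex ring.

Set Implicit Arguments.
Unset Strict Implicit.
Unset Printing Implicit Defensive.

Import GRing.Theory.
Local Open Scope ring_scope.
Local Open Scope quotient_scope.

Definition in_ideal (P : comPzRingType) (s : seq P) (f : P) : Prop :=
  exists c : nat -> P, f = \sum_(i < size s) c i * s`_i.

Section Flat.
Variables (A B : comPzRingType) (f : {rmorphism A -> B}).

Definition balanced (M : lmodType A) (P : zmodType) (beta : M -> B -> P) : Prop :=
  [/\ forall m m' b, beta (m + m') b = beta m b + beta m' b,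
      forall m b b', beta m (b + b') = beta m b + beta m b'
    & forall a m b, beta (a *: m) b = beta m (f a * b)].

(* An element of M (x)_A B is written as a finite list of pairs (m, b),        *)
(* standing for the sum of the m (x) b. By the universal property of the      *)
(* tensor product it is zero iff every balanced map sends it to zero.         *)
Definition tensor_eq0 (M : lmodType A) (s : seq (M * B)) : Prop :=
  forall (P : zmodType) (beta : M -> B -> P), balanced beta ->
    \sum_(x <- s) beta x.1 x.2 = 0.

(* B is A-flat: M (x) B -> N (x) B is injective for all injective u : M -> N. *)
Definition flat_rmorphism : Prop :=
  forall (M N : lmodType A) (u : {linear M -> N}), injective u ->
    forall s : seq (M * B),
      tensor_eq0 [seq (u x.1, x.2) | x <- s] -> tensor_eq0 s.
End Flat.

Definition finitely_presented (A : comNzRingType) (B : comPzRingType)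
    (f : {rmorphism A -> B}) : Prop :=
  exists (n : nat) (g : {rmorphism {mpoly A[n]} -> B}),
    [/\ forall a, g a%:MP = f a,
        forall b, exists q, g q = b
      & exists s : seq {mpoly A[n]}, forall q, g q = 0 <-> in_ideal s q].

(* Infinitesimal lifting along surjections with square-zero kernel. *)
Definition formally_smooth (A B : comPzRingType) (f : {rmorphism A -> B}) : Prop :=
  forall (T T0 : comPzRingType) (r : {rmorphism T -> T0}),
    (forall y, exists x, r x = y) ->
    (forall x y, r x = 0 -> r y = 0 -> x * y = 0) ->
    forall (g : {rmorphism A -> T}) (h : {rmorphism B -> T0}),
      (forall a, h (f a) = r (g a)) ->
      exists h' : {rmorphism B -> T},
        (forall a, h' (f a) = g a) /\ (forall b, r (h' b) = h b).

(* EGA IV 17.3.1. *)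
Definition smooth_rmorphism (A : comNzRingType) (B : comPzRingType)
    (f : {rmorphism A -> B}) : Prop :=
  finitely_presented f /\ formally_smooth f.

(* A scheme of finite type over a field, known through a cover by affine      *)
(* opens Spec (chart_ring c): [point] parametrizes its closed points          *)
(* (possibly with repetitions) and [in_chart c x] says that x lies in the     *)
(* open set c.                                                                *)
Record charted_scheme := ChartedScheme {
  point : Type;
  chart : Type;
  in_chart : chart -> point -> Prop;
  chart_ring : chart -> comPzRingType }.

(* Smoothness of a morphism to Spec A, given by its comorphisms on the charts: *)
(* each point has an affine open neighbourhood whose ring is smooth over A.    *)
(* The locus where this holds is open, so closed points suffice.               *)
Definition smooth_morphism (X : charted_scheme) (A : comNzRingType)
    (phi : forall c : chart X, {rmorphism A -> chart_ring c}) : Prop :=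
  forall x : point X, exists c : chart X,
    in_chart c x /\ smooth_rmorphism (phi c).

Section GenIdeal.
Variables (P : comNzRingType) (s : seq P).
Hypothesis s_proper : ~ in_ideal s 1.

Definition gen_ideal (_ : ~ in_ideal s 1) : {pred P} :=
  fun f => `[< in_ideal s f >].

Fact gen_ideal_closed : idealr_closed (gen_ideal s_proper).
Proof.
split.
- apply/asboolP; exists (fun=> 0).
  by rewrite big1 // => i _; rewrite mul0r.
- by apply/asboolP.
- move=> a u v /asboolP[c ->] /asboolP[d ->]; apply/asboolP.
  exists (fun i => a * c i + d i).
  rewrite mulr_sumr -big_split /=; apply: eq_bigr => i _.
  by rewrite mulrDl mulrA.
Qed.

HB.instance Definition _ := isIdealr.Build P (gen_ideal s_proper) gen_ideal_closed.

Definition gquot : comNzRingType := {ideal_quot (gen_ideal s_proper)}.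
Definition gproj : {rmorphism P -> gquot} := \pi_({ideal_quot (gen_ideal s_proper)}).

Lemma gproj_eq0 x : gproj x = 0 <-> in_ideal s x.
Proof.
split=> [/eqP|H].
  rewrite -(rmorph0 gproj) -Quotient.idealrBE subr0.
  by move/asboolP.
by apply/eqP; rewrite -(rmorph0 gproj) -Quotient.idealrBE subr0; apply/asboolP.
Qed.

Lemma gproj_repr (x : gquot) : gproj (repr x) = x.
Proof. exact: reprK. Qed.

Section Lift.
Variables (S : comPzRingType) (g : {rmorphism P -> S}).
Hypothesis g_s : forall x, x \in s -> g x = 0.

Definition glift (_ : forall x, x \in s -> g x = 0) (x : gquot) : S := g (repr x).

Lemma glift_proj x : glift g_s (gproj x) = g x.
Proof.
apply/eqP; rewrite -subr_eq0 -rmorphB; apply/eqP.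
have /gproj_eq0[c ->] : gproj (repr (gproj x) - x) = 0.
  by rewrite rmorphB gproj_repr subrr.
rewrite rmorph_sum big1 // => i _.
by rewrite rmorphM (g_s (mem_nth _ (ltn_ord i))) mulr0.
Qed.

Fact glift_zmod : zmod_morphism (glift g_s).
Proof.
move=> x y; rewrite -[x]gproj_repr -[y]gproj_repr -rmorphB !glift_proj.
exact: rmorphB.
Qed.

Fact glift_monoid : monoid_morphism (glift g_s).
Proof.
split=> [|x y]; first by rewrite -(rmorph1 gproj) glift_proj rmorph1.
rewrite -[x]gproj_repr -[y]gproj_repr -rmorphM !glift_proj.
exact: rmorphM.
Qed.

HB.instance Definition _ := GRing.isZmodMorphism.Build gquot S (glift g_s) glift_zmod.
HB.instance Definition _ :=
  GRing.isMonoidMorphism.Build gquot S (glift g_s) glift_monoid.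
End Lift.
End GenIdeal.

Section Localization.
Variables (R : comNzRingType) (f : R).

Definition loc_rel (x y : R * nat) : bool :=
  `[< exists m, f ^+ m * (x.1 * f ^+ y.2 - y.1 * f ^+ x.2) = 0 >].

Fact loc_rel_equiv : equiv_class_of loc_rel.
Proof.
split.
- by move=> x; apply/asboolP; exists 0%N; rewrite subrr mulr0.
- move=> x y; apply/asboolP/asboolP => -[m Hm]; exists m;
    by rewrite -opprB mulrN Hm oppr0.
- move=> y x z /asboolP[m Hm] /asboolP[n Hn]; apply/asboolP.
  exists (m + n + y.2)%N.
  transitivity (f ^+ n * f ^+ z.2 * (f ^+ m * (x.1 * f ^+ y.2 - y.1 * f ^+ x.2))
     + f ^+ m * f ^+ x.2 * (f ^+ n * (y.1 * f ^+ z.2 - z.1 * f ^+ y.2))).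
    by rewrite !exprD; ring.
  by rewrite Hm Hn !mulr0 addr0.
Qed.
Canonical loc_rel_equivrel := EquivRelPack loc_rel_equiv.

Definition loc := {eq_quot loc_rel}.
HB.instance Definition _ := Choice.on loc.
HB.instance Definition _ := EqQuotient.on loc.

Definition frac (s : R) (k : nat) : loc := \pi_loc (s, k).

Lemma frac_eq s k s' k' :
  frac s k = frac s' k' <-> exists m, f ^+ m * (s * f ^+ k' - s' * f ^+ k) = 0.
Proof.
split=> [/eqmodP/asboolP //|H].
by apply/eqmodP/asboolP.
Qed.

Lemma frac_surj (z : loc) : exists s k, z = frac s k.
Proof. by exists (repr z).1, (repr z).2; rewrite /frac -surjective_pairing reprK. Qed.

Definition loc_add (z z' : loc) : loc :=
  let: ((s, k), (s', k')) := (repr z, repr z') in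
  frac (s * f ^+ k' + s' * f ^+ k) (k + k').
Definition loc_opp (z : loc) : loc := let: (s, k) := repr z in frac (- s) k.
Definition loc_mul (z z' : loc) : loc :=
  let: ((s, k), (s', k')) := (repr z, repr z') in frac (s * s') (k + k').

Lemma loc_addE s k s' k' :
  loc_add (frac s k) (frac s' k') = frac (s * f ^+ k' + s' * f ^+ k) (k + k').
Proof.
rewrite /loc_add.
have: frac (repr (frac s k)).1 (repr (frac s k)).2 = frac s k.
  by rewrite /frac -surjective_pairing reprK.
have: frac (repr (frac s' k')).1 (repr (frac s' k')).2 = frac s' k'.
  by rewrite /frac -surjective_pairing reprK.
case: (repr _) => t' l' /=; case: (repr _) => t l /= /frac_eq[m' E'] /frac_eq[m E].
apply/frac_eq; exists (m + m')%N; rewrite !exprD.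
transitivity (f ^+ m' * f ^+ l' * f ^+ k' * (f ^+ m * (t * f ^+ k - s * f ^+ l))
   + f ^+ m * f ^+ l * f ^+ k * (f ^+ m' * (t' * f ^+ k' - s' * f ^+ l'))).
  by ring.
by rewrite E E' !mulr0 addr0.
Qed.

Lemma loc_oppE s k : loc_opp (frac s k) = frac (- s) k.
Proof.
rewrite /loc_opp.
have: frac (repr (frac s k)).1 (repr (frac s k)).2 = frac s k.
  by rewrite /frac -surjective_pairing reprK.
case: (repr _) => t l /= /frac_eq[m E]; apply/frac_eq; exists m.
transitivity (- (f ^+ m * (t * f ^+ k - s * f ^+ l))); first by ring.
by rewrite E oppr0.
Qed.

Lemma loc_mulE s k s' k' :
  loc_mul (frac s k) (frac s' k') = frac (s * s') (k + k').
Proof.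
rewrite /loc_mul.
have: frac (repr (frac s k)).1 (repr (frac s k)).2 = frac s k.
  by rewrite /frac -surjective_pairing reprK.
have: frac (repr (frac s' k')).1 (repr (frac s' k')).2 = frac s' k'.
  by rewrite /frac -surjective_pairing reprK.
case: (repr _) => t' l' /=; case: (repr _) => t l /= /frac_eq[m' E'] /frac_eq[m E].
apply/frac_eq; exists (m + m')%N; rewrite !exprD.
transitivity (f ^+ m' * (t' * f ^+ k') * (f ^+ m * (t * f ^+ k - s * f ^+ l))
   + f ^+ m * s * f ^+ l * (f ^+ m' * (t' * f ^+ k' - s' * f ^+ l'))).
  by ring.
by rewrite E E' !mulr0 addr0.
Qed.

Lemma frac_eqE s k s' k' : s * f ^+ k' = s' * f ^+ k -> frac s k = frac s' k'.
Proof. by move=> E; apply/frac_eq; exists 0%N; rewrite E subrr mulr0. Qed.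

Fact loc_addA : associative loc_add.
Proof.
move=> x y z; have [s [k ->]] := frac_surj x; have [t [l ->]] := frac_surj y.
have [u [m ->]] := frac_surj z.
by rewrite !loc_addE; apply: frac_eqE; rewrite !exprD; ring.
Qed.
Fact loc_addC : commutative loc_add.
Proof.
move=> x y; have [s [k ->]] := frac_surj x; have [t [l ->]] := frac_surj y.
by rewrite !loc_addE; apply: frac_eqE; rewrite !exprD; ring.
Qed.
Fact loc_add0 : left_id (frac 0 0) loc_add.
Proof.
move=> x; have [s [k ->]] := frac_surj x.
by rewrite !loc_addE; apply: frac_eqE; rewrite !exprD; ring.
Qed.
Fact loc_addN : left_inverse (frac 0 0) loc_opp loc_add.
Proof.
move=> x; have [s [k ->]] := frac_surj x.
by rewrite loc_oppE !loc_addE; apply: frac_eqE; rewrite !exprD; ring.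
Qed.
HB.instance Definition _ :=
  GRing.isZmodule.Build loc loc_addA loc_addC loc_add0 loc_addN.

Fact loc_mulA : associative loc_mul.
Proof.
move=> x y z; have [s [k ->]] := frac_surj x; have [t [l ->]] := frac_surj y.
have [u [m ->]] := frac_surj z.
by rewrite !loc_mulE; apply: frac_eqE; rewrite !exprD; ring.
Qed.
Fact loc_mulC : commutative loc_mul.
Proof.
move=> x y; have [s [k ->]] := frac_surj x; have [t [l ->]] := frac_surj y.
by rewrite !loc_mulE; apply: frac_eqE; rewrite !exprD; ring.
Qed.
Fact loc_mul1 : left_id (frac 1 0) loc_mul.
Proof.
move=> x; have [s [k ->]] := frac_surj x.
by rewrite !loc_mulE; apply: frac_eqE; rewrite !exprD; ring.
Qed.
Fact loc_mulDl : left_distributive loc_mul loc_add.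
Proof.
move=> x y z; have [s [k ->]] := frac_surj x; have [t [l ->]] := frac_surj y.
have [u [m ->]] := frac_surj z.
by rewrite !(loc_mulE, loc_addE); apply: frac_eqE; rewrite !exprD; ring.
Qed.
HB.instance Definition _ :=
  GRing.Zmodule_isComPzRing.Build loc loc_mulA loc_mulC loc_mul1 loc_mulDl.

Lemma fracB s k s' k' :
  frac s k - frac s' k' = frac (s * f ^+ k' - s' * f ^+ k) (k + k').
Proof.
have -> : - frac s' k' = frac (- s') k' := loc_oppE _ _.
by rewrite -mulNr; apply: loc_addE.
Qed.
Lemma fracM s k s' k' : frac s k * frac s' k' = frac (s * s') (k + k').
Proof. exact: loc_mulE. Qed.
Lemma frac10 : frac 1 0 = 1.
Proof. by []. Qed.
End Localization.

Arguments frac {R} f s k.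

Definition arm1 : 'I_3 := @Ordinal 3 0 isT.
Definition arm2 : 'I_3 := @Ordinal 3 1 isT.
Definition arm3 : 'I_3 := @Ordinal 3 2 isT.

Section Quiver.
Variable p : 'I_3 -> nat.

(* [inl] (i, j) with j : 'I_(p i).-1 is the interior vertex x_{i,j+1};  *)
(* [inr true] is the top vertex 0 and [inr false] the bottom vertex b_0. *)
Definition vertex : finType := ({i : 'I_3 & 'I_(p i).-1} + bool)%type.
Definition top : vertex := inr true.
Definition bottom : vertex := inr false.

(* x_{i,j} for 0 <= j <= p_i, so that x_{i,0} = 0 and x_{i,p_i} = b_0. *)
Definition xvert (i : 'I_3) (j : nat) : vertex :=
  if j is j'.+1 then
    if insub j' is Some k then inl (Tagged (fun i => 'I_(p i).-1) (k : 'I_(p i).-1))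
    else bottom
  else top.

(* With j : 'I_(p i), the arrow ((i, j), true) is d_{i,j+1} and ((i, j), false) *)
(* is u_{i,j+1}. *)
Definition arrow : finType := ({i : 'I_3 & 'I_(p i)} * bool)%type.
Definition dn (i : 'I_3) (j : 'I_(p i)) : arrow := (Tagged (fun i => 'I_(p i)) j, true).
Definition up (i : 'I_3) (j : 'I_(p i)) : arrow := (Tagged (fun i => 'I_(p i)) j, false).

Definition tail_of (a : arrow) : vertex :=
  let: (existT i j, down) := a in if down then xvert i j else xvert i j.+1.
Definition head_of (a : arrow) : vertex :=
  let: (existT i j, down) := a in if down then xvert i j.+1 else xvert i j.

(* s is a path from q to r: its first arrow is the one followed first. *)
Fixpoint is_path (q : vertex) (s : seq arrow) (r : vertex) : bool :=
  if s is a :: s' then (tail_of a == q) && is_path (head_of a) s' r else q == r.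

Definition theta0 (q : vertex) : int :=
  if q == top then - (\sum_i (p i).-1 + 1)%N%:Z else 1.

End Quiver.

Arguments top {p}.
Arguments bottom {p}.

Fact ord_pred_lt n (j : 'I_n.-1) : (j < n)%N.
Proof. exact: leq_trans (ltn_ord j) (leq_pred n). Qed.
Fact ord_succ_lt n (j : 'I_n.-1) : (j.+1 < n)%N.
Proof. by move: (ltn_ord j); rewrite ltn_predRL. Qed.

Definition low n (j : 'I_n.-1) : 'I_n := Ordinal (ord_pred_lt j).
Definition high n (j : 'I_n.-1) : 'I_n := Ordinal (ord_succ_lt j).

Section Rings.
Variables (F : fieldType) (p : 'I_3 -> nat).

Definition polys (T : finType) : comNzRingType := {mpoly F[#|T|]}.
Definition pvar (T : finType) (t : T) : polys T := 'X_(enum_rank t).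
Definition psubst (T : finType) (S : comNzRingType) (c : {rmorphism F -> S})
    (h : T -> S) : {rmorphism polys T -> S} := mmap c (fun k => h (enum_val k)).
Definition peval (T : finType) (x : T -> F) : {rmorphism polys T -> F} :=
  psubst idfun x.

Lemma psubst_var T S c h t : @psubst T S c h (pvar t) = h t.
Proof. by rewrite /psubst /pvar /= mmapX mmap1U enum_rankK. Qed.

Definition Dpath (i : 'I_3) : polys (arrow p) := \prod_(j < p i) pvar (dn j).

Definition rep_rel : polys (arrow p) := Dpath arm1 - Dpath arm2 + Dpath arm3.

(* Coordinates on the space containing Delta: gamma_{i,j} and A, B, a, b. *)
Definition dcoord : finType := ({i : 'I_3 & 'I_(p i).-1} + 'I_4)%type.
Definition gam (i : 'I_3) (j : 'I_(p i).-1) : polys dcoord :=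
  pvar (inl (Tagged (fun i => 'I_(p i).-1) j)).
Definition cA : polys dcoord := pvar (inr (@Ordinal 4 0 isT)).
Definition cB : polys dcoord := pvar (inr (@Ordinal 4 1 isT)).
Definition ca : polys dcoord := pvar (inr (@Ordinal 4 2 isT)).
Definition cb : polys dcoord := pvar (inr (@Ordinal 4 3 isT)).

Definition delta_eqs : seq (polys dcoord) :=
  [:: \sum_(j < (p arm1).-1) gam j - \sum_(j < (p arm2).-1) gam j + cA + ca;
      \sum_(j < (p arm3).-1) gam j - \sum_(j < (p arm2).-1) gam j + cB + cb].

Lemma proper_of_zero (T : finType) (x : T -> F) (s : seq (polys T)) :
  (forall f, f \in s -> peval x f = 0) -> ~ in_ideal s 1.
Proof.
move=> Hs [c /(congr1 (peval x)) /eqP].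
rewrite rmorph1 rmorph_sum big1 ?oner_eq0 // => i _.
by rewrite rmorphM (Hs _ (mem_nth _ (ltn_ord i))) mulr0.
Qed.

Fact delta_proper : ~ in_ideal delta_eqs 1.
Proof.
apply: (@proper_of_zero _ (fun=> 0)) => f.
have H0 (t : dcoord) : peval (fun=> 0) (pvar t) = 0 by rewrite psubst_var.
have HS i : peval (fun=> 0) (\sum_(j < (p i).-1) gam j) = 0.
  by rewrite rmorph_sum big1 // => j _; apply: H0.
by rewrite !inE => /orP[] /eqP ->;
  rewrite (rmorphD _ (_ + _)) (rmorphD _ (_ - _)) rmorphB !HS !H0 subrr !addr0.
Qed.

Definition deltaRing : comNzRingType := gquot delta_proper.

Hypothesis hp : forall i, (1 < p i)%N.

Fact relation_proper : ~ in_ideal [:: rep_rel] 1.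
Proof.
apply: (@proper_of_zero _ (fun=> 0)) => f; rewrite inE => /eqP ->.
have H i : peval (fun=> 0) (Dpath i) = 0.
  rewrite rmorph_prod (eq_bigr (fun=> 0)) => [|j _]; last exact: psubst_var.
  by rewrite (bigD1 (Ordinal (ltnW (hp i)))) //= mul0r.
by rewrite rmorphD rmorphB !H subrr addr0.
Qed.

(* C[Rep(CQ, delta)] / I. *)
Definition repRing : comNzRingType := gquot relation_proper.
Definition repProj : {rmorphism polys (arrow p) -> repRing} :=
  gproj relation_proper.
Definition repC : {rmorphism F -> repRing} := repProj \o @mpolyC #|arrow p| F.

Definition torus := {mu : vertex p -> F | forall q, mu q != 0}.

Definition act_poly (mu : torus) : {rmorphism polys (arrow p) -> polys (arrow p)} :=
  psubst (@mpolyC #|arrow p| F)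
    (fun a => ((sval mu (tail_of a))^-1)%:MP * pvar a * (sval mu (head_of a))%:MP).

Lemma act_var mu a : act_poly mu (pvar a) =
  ((sval mu (tail_of a))^-1)%:MP * pvar a * (sval mu (head_of a))%:MP.
Proof. exact: psubst_var. Qed.

Lemma xvert_last i : xvert p i (p i) = bottom.
Proof.
have -> : xvert p i (p i) = xvert p i (p i).-1.+1 by rewrite prednK // ltnW.
by rewrite /= insubF // ltnn.
Qed.

Lemma act_Dpath mu i :
  act_poly mu (Dpath i) =
  ((sval mu top)^-1 * sval mu bottom)%:MP * Dpath i.
Proof.
pose m j := sval mu (xvert p i j).
rewrite rmorph_prod (eq_bigr (fun j : 'I_(p i) =>
  ((m j)^-1 * m j.+1)%:MP * pvar (dn j))); last first.
  by move=> j _; rewrite act_var /= mulrAC -mpolyCM.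
rewrite big_split /=; congr (_ * _).
rewrite -(xvert_last i) -(rmorph_prod (@mpolyC _ _)); congr (_%:MP).
rewrite -(big_mkord xpredT (fun j => (m j)^-1 * m j.+1)).
rewrite (eq_bigr (fun j => m j.+1 / m j)); last by move=> j _; rewrite mulrC.
rewrite telescope_prodf; first by rewrite mulrC.
- by move=> k _; exact: (svalP mu).
- exact: ltnW.
Qed.

Definition act_pre (mu : torus) : {rmorphism polys (arrow p) -> repRing} :=
  repProj \o act_poly mu.

Fact act_relation mu : forall g, g \in [:: rep_rel] -> act_pre mu g = 0.
Proof.
move=> g; rewrite inE => /eqP -> /=; apply/gproj_eq0.
exists (fun=> ((sval mu top)^-1 * sval mu bottom)%:MP).
by rewrite big_ord1 /= rmorphD rmorphB !act_Dpath mulrDr mulrBr.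
Qed.

Definition torus_act (mu : torus) : {rmorphism repRing -> repRing} := glift (act_relation mu).

Lemma act_proj mu g : torus_act mu (repProj g) = repProj (act_poly mu g).
Proof. exact: (glift_proj _ (act_relation mu)). Qed.

Lemma act_scal mu c : torus_act mu (repC c) = repC c.
Proof.
have -> : repC c = repProj c%:MP by [].
by rewrite act_proj; congr (repProj _); exact: mmapC.
Qed.

Definition chi0 (mu : torus) : F := \prod_q sval mu q ^ theta0 q.

Definition semi_inv (n : nat) (g : repRing) : Prop :=
  forall mu, torus_act mu g = repC (chi0 mu ^+ n) * g.

Definition is_inv : {pred repRing} := fun g => `[< forall mu, torus_act mu g = g >].

Fact is_inv_closed : subring_closed is_inv.
Proof.
split.
- by apply/asboolP => mu; rewrite rmorph1.
- move=> g h /asboolP Hg /asboolP Hh; apply/asboolP => mu.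
  by rewrite rmorphB Hg Hh.
- move=> g h /asboolP Hg /asboolP Hh; apply/asboolP => mu.
  by rewrite rmorphM Hg Hh.
Qed.
HB.instance Definition _ := GRing.isSubringClosed.Build repRing is_inv is_inv_closed.

Record inv_ring := InvRing { inv_val :> repRing; inv_valP : is_inv inv_val }.
HB.instance Definition _ := [isSub for inv_val].
HB.instance Definition _ := [Choice of inv_ring by <:].
HB.instance Definition _ := [SubChoice_isSubComNzRing of inv_ring by <:].

(* v_{i,j+1} = d_{i,j+1} u_{i,j+1}. *)
Definition v_rep i (j : 'I_(p i)) : repRing := repProj (pvar (dn j) * pvar (up j)).

Fact v_is_inv i (j : 'I_(p i)) : is_inv (v_rep j).
Proof.
apply/asboolP => mu; rewrite /v_rep act_proj rmorphM !act_var /=; congr (repProj _).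
have nz q : sval mu q != 0 := svalP mu q.
set x := sval mu _; set y := sval mu _.
transitivity ((x^-1 * x)%:MP * (y^-1 * y)%:MP * (pvar (dn j) * pvar (up j))).
  by rewrite !mpolyCM; ring.
by rewrite (mulVf (nz _)) (mulVf (nz _)) mpolyC1 !mul1r.
Qed.
Definition vv i (j : 'I_(p i)) : inv_ring := InvRing (v_is_inv j).

Fact repC_is_inv c : is_inv (repC c).
Proof. apply/asboolP => mu; exact (act_scal mu c). Qed.
Definition invC_val (c : F) : inv_ring := InvRing (repC_is_inv c).

Fact invC_zmod : zmod_morphism invC_val.
Proof. move=> x y; apply: val_inj; exact (rmorphB repC x y). Qed.
Fact invC_monoid : monoid_morphism invC_val.
Proof.
split=> [|x y]; apply: val_inj; [exact (rmorph1 repC)|exact (rmorphM repC x y)].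
Qed.
HB.instance Definition _ := GRing.isZmodMorphism.Build F inv_ring invC_val invC_zmod.
HB.instance Definition _ := GRing.isMonoidMorphism.Build F inv_ring invC_val invC_monoid.

Definition afirst i : 'I_(p i) := Ordinal (ltnW (hp i)).
Fact last_lt i : ((p i).-1 < p i)%N.
Proof. by rewrite ltn_predL; apply: ltnW. Qed.
Definition alast i : 'I_(p i) := Ordinal (last_lt i).

Definition pi_coord (c : dcoord) : inv_ring :=
  match c with
  | inl (existT i j) => vv (low j) - vv (high j)
  | inr k =>
      [:: vv (alast arm1) - vv (alast arm2); vv (alast arm3) - vv (alast arm2);
          vv (afirst arm2) - vv (afirst arm1); vv (afirst arm2) - vv (afirst arm3)]`_k
  end.

Definition pi_poly : {rmorphism polys (dcoord) -> inv_ring} :=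
  psubst invC_val pi_coord.

Lemma pi_gam_sum i :
  pi_poly (\sum_(j < (p i).-1) gam j) = vv (afirst i) - vv (alast i).
Proof.
pose w j := if insub j is Some k then - vv (k : 'I_(p i)) else 0.
have wE (j : 'I_(p i)) : w j = - vv j by rewrite /w valK.
rewrite rmorph_sum (eq_bigr (fun j : 'I_(p i).-1 => w j.+1 - w j)); last first.
  move=> j _; rewrite [LHS]psubst_var /=.
  have -> : w j = - vv (low j) := wE (low j).
  have -> : w j.+1 = - vv (high j) := wE (high j).
  by rewrite opprK addrC.
rewrite -(big_mkord xpredT (fun j => w j.+1 - w j)) telescope_sumr //.
have -> : w 0%N = - vv (afirst i) := wE (afirst i).
have -> : w (p i).-1 = - vv (alast i) := wE (alast i).
by rewrite opprK addrC.
Qed.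

Fact pi_delta : forall g, g \in delta_eqs -> pi_poly g = 0.
Proof.
have HX t : pi_poly (pvar t) = pi_coord t := psubst_var _ _ _.
move=> g; rewrite !inE => /orP[] /eqP ->;
  rewrite (rmorphD _ (_ + _)) (rmorphD _ (_ - _)) rmorphB !pi_gam_sum !HX /=; ring.
Qed.

(* The comorphism C[Delta] -> R^G of pi. *)
Definition pi_comorph : {rmorphism deltaRing -> inv_ring} := glift pi_delta.

(* Points of Rep(CQ/I, delta), as values of the arrows. *)
Definition is_rep (x : arrow p -> F) : Prop :=
  forall g, g \in [:: rep_rel] -> peval x g = 0.
Definition rep_eval (x : arrow p -> F) (hx : is_rep x) : {rmorphism repRing -> F} :=
  glift hx.

Definition stable (x : arrow p -> F) : Prop :=
  forall q : vertex p, exists s : seq (arrow p),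
    is_path top s q /\ \prod_(a <- s) x a != 0.

Record stable_rep := StableRep {
  rep_val : arrow p -> F;
  rep_valP : is_rep rep_val;
  rep_stable : stable rep_val }.

(* A semi-invariant f of weight n * theta0 with n > 0 gives an affine open of  *)
(* the GIT quotient, namely D(f) / G; its coordinate ring is that of the       *)
(* G-invariant functions on D(f), i.e. the invariants of R localized at f.     *)
Record git_chart := GitChart {
  ch_sec : repRing;
  ch_wt : nat;
  ch_wt_gt0 : (0 < ch_wt)%N;
  ch_semi : semi_inv ch_wt ch_sec }.

Section Chart.
Variable c : git_chart.

Local Notation f := (ch_sec c).

(* mu . (s / f^k) = (mu . s) / (mu . f)^k, where mu . f = chi0(mu)^n f. *)
Definition loc_act (mu : torus) (z : loc f) : loc f :=
  frac f (repC ((chi0 mu ^+ ch_wt c)^-1 ^+ (repr z).2) * torus_act mu (repr z).1)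
    (repr z).2.

Lemma chi0_neq0 mu : chi0 mu != 0.
Proof. by apply/prodf_neq0 => q _; rewrite expfz_neq0 // (svalP mu). Qed.

Lemma repC_cancel x k : x != 0 -> repC (x^-1 ^+ k) * repC x ^+ k = 1.
Proof.
move=> nz; rewrite -(rmorphXn repC) -(rmorphM repC) -exprMn mulVf // expr1n.
exact (rmorph1 repC).
Qed.

Lemma loc_actE mu s k : loc_act mu (frac f s k) =
  frac f (repC ((chi0 mu ^+ ch_wt c)^-1 ^+ k) * torus_act mu s) k.
Proof.
rewrite /loc_act.
have: frac f (repr (frac f s k)).1 (repr (frac f s k)).2 = frac f s k.
  by rewrite /frac -surjective_pairing reprK.
move: (repr _).1 (repr _).2 => t l /frac_eq[m /(congr1 (torus_act mu))].
rewrite rmorph0 rmorphM rmorphB !(rmorphM (torus_act mu)) !(rmorphXn (torus_act mu)).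
rewrite (ch_semi c mu) !exprMn.
set x := chi0 mu ^+ _; have nz : x != 0 by rewrite expf_neq0 // chi0_neq0.
have Km := repC_cancel m nz; have Kk := repC_cancel k nz; have Kl := repC_cancel l nz.
move: (repC (x^-1 ^+ m)) (repC (x^-1 ^+ k)) (repC (x^-1 ^+ l)) (repC x)
  (torus_act mu t) (torus_act mu s) Km Kk Kl => em ek el e t' s' Km Kk Kl H.
apply/frac_eq; exists m.
transitivity (em * ek * el * (e ^+ m * f ^+ m *
  (t' * (e ^+ k * f ^+ k) - s' * (e ^+ l * f ^+ l)))); last by rewrite H mulr0.
transitivity ((em * e ^+ m) * f ^+ m * ((ek * e ^+ k) * el * t' * f ^+ k
  - (el * e ^+ l) * ek * s' * f ^+ l)); last by ring.
by rewrite Km Kk Kl !mul1r.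
Qed.

Fact loc_act_zmod mu : zmod_morphism (loc_act mu).
Proof.
move=> z w; have [s [k ->]] := frac_surj z; have [t [l ->]] := frac_surj w.
rewrite fracB !loc_actE fracB; congr (frac _ _ _).
rewrite rmorphB !(rmorphM (torus_act mu)) !(rmorphXn (torus_act mu)).
rewrite (ch_semi c mu) !exprMn exprD (rmorphM repC).
set x := chi0 mu ^+ _; have nz : x != 0 by rewrite expf_neq0 // chi0_neq0.
have Kk := repC_cancel k nz; have Kl := repC_cancel l nz.
move: (repC (x^-1 ^+ k)) (repC (x^-1 ^+ l)) (repC x)
  (torus_act mu t) (torus_act mu s) Kk Kl => ek el e t' s' Kk Kl.
transitivity ((el * e ^+ l) * ek * s' * f ^+ l - (ek * e ^+ k) * el * t' * f ^+ k).
  by ring.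
by rewrite Kk Kl !mul1r.
Qed.

Fact loc_act_monoid mu : monoid_morphism (loc_act mu).
Proof.
split=> [|z w].
  rewrite -(frac10 f) loc_actE expr0 (rmorph1 repC) (rmorph1 (torus_act mu)).
  by rewrite mul1r.
have [s [k ->]] := frac_surj z; have [t [l ->]] := frac_surj w.
rewrite fracM !loc_actE fracM; congr (frac _ _ _).
rewrite (rmorphM (torus_act mu)) exprD (rmorphM repC).
by rewrite mulrACA.
Qed.
HB.instance Definition _ mu :=
  GRing.isZmodMorphism.Build (loc f) (loc f) (loc_act mu) (loc_act_zmod mu).
HB.instance Definition _ mu :=
  GRing.isMonoidMorphism.Build (loc f) (loc f) (loc_act mu) (loc_act_monoid mu).

Definition is_loc_inv : {pred loc f} := fun z => `[< forall mu, loc_act mu z = z >].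

Fact is_loc_inv_closed : subring_closed is_loc_inv.
Proof.
split.
- by apply/asboolP => mu; exact (loc_act_monoid mu).1.
- move=> z w /asboolP Hz /asboolP Hw; apply/asboolP => mu.
  by rewrite loc_act_zmod Hz Hw.
- move=> z w /asboolP Hz /asboolP Hw; apply/asboolP => mu.
  by rewrite (loc_act_monoid mu).2 Hz Hw.
Qed.
HB.instance Definition _ :=
  GRing.isSubringClosed.Build (loc f) is_loc_inv is_loc_inv_closed.

Record git_ring := GitRing { git_val :> loc f; git_valP : is_loc_inv git_val }.
HB.instance Definition _ := [isSub for git_val].
HB.instance Definition _ := [Choice of git_ring by <:].
HB.instance Definition _ :=
  GRing.SubChoice_isSubComPzRing.Build _ _ git_ring is_loc_inv_closed.

Fact inv_loc_inv (g : inv_ring) : is_loc_inv (frac f (inv_val g) 0).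
Proof.
apply/asboolP => mu; rewrite loc_actE expr0 (rmorph1 repC) mul1r.
by have /asboolP -> := inv_valP g.
Qed.

(* The comorphism g |-> g / 1 of the canonical map to the affine quotient. *)
Definition git_comorph (g : inv_ring) : git_ring := GitRing (inv_loc_inv g).

Fact git_comorph_zmod : zmod_morphism git_comorph.
Proof.
move=> g h; apply: val_inj; apply: esym; apply: etrans (fracB _ _ _ _ _) _.
by rewrite !expr0 !mulr1.
Qed.
Fact git_comorph_monoid : monoid_morphism git_comorph.
Proof.
split=> [|g h]; apply: val_inj; first by [].
by apply: esym; apply: etrans (fracM _ _ _ _ _) _.
Qed.
HB.instance Definition _ :=
  GRing.isZmodMorphism.Build inv_ring git_ring git_comorph git_comorph_zmod.
HB.instance Definition _ :=
  GRing.isMonoidMorphism.Build inv_ring git_ring git_comorph git_comorph_monoid.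
End Chart.

(* Stable representations in the same G-orbit name the same point. *)
Definition git_quotient : charted_scheme := {|
  point := stable_rep;
  chart := git_chart;
  in_chart := fun c x => rep_eval (rep_valP x) (ch_sec c) != 0;
  chart_ring := fun c => git_ring c |}.

Definition phi_comorph (c : chart git_quotient) :
    {rmorphism deltaRing -> chart_ring c} :=
  (git_comorph c : {rmorphism inv_ring -> git_ring c}) \o pi_comorph.

End Rings.

Arguments pi_comorph F {p} hp.
Arguments phi_comorph F {p} hp c.

(* Main.v *)
From HB Require Import structures.
Require Import Defs.
From mathcomp Require Import all_boot all_order all_algebra.
From mathcomp Require Import boolp reals.
From mathcomp Require Import mpoly complex ring zify.

(** Write [A] for the ring of functions on [Delta], [R] for the coordinate ring of
    the representations, [P_i] for the product of the [v_{i,j}] on arm [i], and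
    [t = v_{2,1}].

    Flatness of [pi]. Each [v_{i,j}] differs from [t] by a function on [Delta], so the
    [v_{i,j}] generate a polynomial ring [A[t]]. The invariants are generated over
    it by [w_1], [w_2], [w_3] ([inv_generated]), and the mixed products [w_i w_j]
    are linear in the [w_i] ([w_reduce]); hence the powers of the single [w_i] span
    the invariants over [A[t]] ([all_spanned]). They are independent
    ([span_inj0]): on the representations with [D_1 = s], [D_2 = 1], [D_3 = 1 - s] and
    fixed cycles, the [w_i] become multiples of [s], [1 / s] and [1 / (1 - s)], and a
    linear relation among their powers contradicts the uniqueness of partial
    fractions. So the invariant ring is a free [A]-module, and free modules are flat
    ([flat_basis]).

    Smoothness of [phi]. At a stable representation some path from the top to the
    bottom is nonzero, so some [D_i] is, and by the relation two of them are, say on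
    the arms [o] and [o']. The third arm [k] can be cut at one place so that all its
    vertices are reached by descending above the cut and by ascending below it
    ([stable_in_chart]). The corresponding product of paths is a semi-invariant [f]
    of weight [2 theta0]. Where [f] is invertible, the torus can be used to make the
    arrows of a spanning tree equal to 1; what is left is a point of [Delta] and the
    two arrows [x], [y] at the cut, since the cycle at the cut gives
    [t = x y - const], the other cycles then give the other arrows, and the
    relation gives the last arrow of [o'] as a polynomial [delta] in [x], [y] and
    the functions on [Delta] ([gauge_slice]). Hence the ring of invariants of [R_f]
    is [A[x, y]] localized at [delta] ([chart_surj], [chart_inj]), which is smooth
    over [A] ([smooth_localization]).

    Invariance is given for the points of the torus only. It is turned into
    statements about monomials through the grading by weights: in characteristic 0,
    two weights are separated by a point of the torus, so a semi-invariant is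
    represented by monomials of the expected weight
    ([semi_invariant_component]). *)

Set Implicit Arguments.
Unset Strict Implicit.
Unset Printing Implicit Defensive.

Import Order.TTheory GRing.Theory Num.Theory.
Local Open Scope ring_scope.

Local Notation frac := Defs.frac.
Local Arguments xvert : simpl never.
Local Arguments tail_of : simpl never.
Local Arguments head_of : simpl never.

(** * Polynomial rings and ring homomorphisms *)

Section PolynomialRings.

Lemma widen_ordE n (i : 'I_n) : widen_ord (leqnSn n) i = lift ord_max i.
Proof. by apply: val_inj; rewrite /= /bump leqNgt ltn_ord. Qed.

Lemma mpolyX_vars (A : nzRingType) n (m : 'X_{1..n}) :
  'X_[A, m] = \prod_i 'X_i ^+ m i.
Proof.
exact: mpolyXE_id.
Qed.

Lemma mpoly_generated (A : nzRingType) n (P : {mpoly A[n]} -> Prop) :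
  (forall a, P a%:MP) -> (forall i, P 'X_i) ->
  (forall q q', P q -> P q' -> P (q + q')) ->
  (forall q q', P q -> P q' -> P (q * q')) -> forall q, P q.
Proof.
move=> PC PX PD PM; elim/mpolyind => [|c m q _ _ Pq]; first by rewrite -mpolyC0.
apply: (PD) => //; rewrite -mul_mpolyC; apply: (PM) => //; rewrite mpolyX_vars.
apply: (big_ind P) => [|q1 q2|i _]; [by rewrite -mpolyC1 | exact: PM |].
by elim: (m i) => [|k IH]; rewrite ?expr0 -?mpolyC1 // exprS; apply: (PM).
Qed.

Lemma mpoly_hom_ext (A : comNzRingType) n (S : comPzRingType)
    (g h : {rmorphism {mpoly A[n]} -> S}) :
  (forall a, g a%:MP = h a%:MP) -> (forall i, g 'X_i = h 'X_i) -> g =1 h.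
Proof.
move=> gC gX; apply: mpoly_generated => // q q' E E'.
  by rewrite !rmorphD E E'.
by rewrite !rmorphM E E'.
Qed.

(** The target may be the zero ring, in which case the zero map serves. *)
Lemma mpoly_hom_exists (A : comNzRingType) n (S : comPzRingType)
    (h : {rmorphism A -> S}) (x : 'I_n -> S) :
  exists g : {rmorphism {mpoly A[n]} -> S},
    (forall a, g a%:MP = h a) /\ (forall i, g 'X_i = x i).
Proof.
have [S0|/eqP S1] := pselect (1 = 0 :> S).
  have all0 (s : S) : s = 0 by rewrite -[s]mul1r S0 mul0r.
  pose z (_ : {mpoly A[n]}) : S := 0.
  have zB : zmod_morphism z by move=> q q'; rewrite /z subrr.
  have zM : monoid_morphism z by split=> [|q q']; rewrite /z ?mul0r ?S0.
  pose gz : {rmorphism {mpoly A[n]} -> S} := HB.pack z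
    (GRing.isZmodMorphism.Build _ _ z zB) (GRing.isMonoidMorphism.Build _ _ z zM).
  by exists gz; split=> *; rewrite [RHS]all0.
pose S' : comNzRingType := HB.pack_for comNzRingType S
  (GRing.PzSemiRing_isNonZero.Build S S1).
pose h' : {rmorphism A -> S'} := h.
pose g : {rmorphism {mpoly A[n]} -> S'} := mmap h' (x : 'I_n -> S').
exists g; split=> [a|i]; first exact: (@mmapC n A S' x h' a).
exact: etrans (@mmapX n A S' x h' U_(i)%MM) (mmap1U (S := S') x i).
Qed.



(** The finite set [r] of excluded points is what allows the arguments below to
    stay away from the zeros of denominators. *)
Lemma poly_eq0_values (F : numDomainType) (q : {poly F}) (r : seq F) :
  (forall c, c \notin r -> q.[c] = 0) -> q = 0.
Proof.
move=> qr; pose q' := q * \prod_(c <- r) ('X - c%:P).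
have q'0 c : q'.[c] = 0.
  have [cr|/qr q0] := boolP (c \in r); last by rewrite hornerM q0 mul0r.
  by rewrite hornerM horner_prod (big_rem c) //= hornerXsubC subrr mul0r mulr0.
have /eqP : q' = 0.
  apply/eqP; apply: contraT => nz.
  have := max_poly_roots (rs := [seq i%:R | i <- iota 0 (size q')]) nz.
  rewrite size_map size_iota ltnn => -> //.
    by apply/allP => c _; apply/rootP.
  rewrite map_inj_uniq ?iota_uniq // => i j /eqP.
  by rewrite Num.Theory.eqr_nat => /eqP.
rewrite mulf_eq0 => /orP[/eqP //|].
by rewrite (negPf (monic_neq0 (monic_prod_XsubC r xpredT id))).
Qed.

Lemma mpoly_eq0_values (F : numDomainType) n (q : {mpoly F[n]}) :
  (forall x : 'I_n -> F, mmap idfun x q = 0) -> q = 0.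
Proof.
elim: n q => [|n IH] q qx.
  have qC := nvar0_mpolyC q; have := qx (fun=> 0).
  by rewrite qC (mmapC _ idfun) /= => ->; rewrite mpolyC0.
(* Each coefficient of [q] as a polynomial in its last variable vanishes at all
   points of the other variables. *)
pose restr (m : 'X_{1..n.+1}) : 'X_{1..n} := [multinom m (widen_ord (leqnSn n) i) | i < n].
have qk k : \sum_(m <- msupp q | m ord_max == k) q@_m *: 'X_[restr m] = 0.
  apply: IH => x.
  pose Q := \sum_(m <- msupp q) (q@_m * mmap1 x (restr m)) *: 'X^(m ord_max).
  have Q0 : Q = 0.
    apply: (@poly_eq0_values _ _ [::]) => c _.
    rewrite -[RHS](qx (fun i => oapp x c (unlift ord_max i))) /mmap horner_sum.
    apply: eq_bigr => m _; rewrite hornerZ hornerXn -mulrA; congr (_ * _).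
    rewrite /mmap1 big_ord_recr /= unlift_none /=; congr (_ * _).
    apply: eq_bigr => i _; rewrite mnmE.
    by rewrite widen_ordE liftK.
  move: (congr1 (fun P : {poly F} => P`_k) Q0).
  rewrite coef0 coef_sum raddf_sum /= => E; rewrite -[RHS]E [LHS]big_mkcond.
  apply: eq_bigr => m _; rewrite coefZ coefXn eq_sym.
  by case: eqP => _; rewrite ?mulr0 // mmapZ mmapX mulr1.
apply/mpolyP => m0; rewrite mcoeff0; apply/eqP; rewrite mcoeff_eq0.
apply/negP => m0q; have := m0q; rewrite -[_ \in _]negbK -mcoeff_eq0 => /negP; apply.
move: (congr1 (mcoeff (restr m0)) (qk (m0 ord_max))).
rewrite mcoeff0 raddf_sum /= big_mkcond (bigD1_seq m0) //= eqxx mcoeffZ mcoeffX.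
rewrite eqxx mulr1 big1 ?addr0 => [-> //|m mm0]; case: eqP => // mk.
rewrite mcoeffZ mcoeffX; case: eqP => [E|]; last by rewrite mulr0.
case/eqP: mm0; apply/mnmP => i.
have [j ->|->] := unliftP ord_max i; last exact: mk.
by move/mnmP/(_ j): E; rewrite !mnmE widen_ordE.
Qed.

Lemma hom_factor (P B T : comPzRingType) (g : {rmorphism P -> B})
    (H : {rmorphism P -> T}) :
  (forall b, exists q, g q = b) -> (forall q, g q = 0 -> H q = 0) ->
  exists h : {rmorphism B -> T}, forall q, h (g q) = H q.
Proof.
move=> gsurj gker; have [s sK] := choice gsurj.
pose h b := H (s b).
have hg q : h (g q) = H q.
  by apply/eqP; rewrite -subr_eq0 -rmorphB gker // rmorphB sK subrr.
have hB : zmod_morphism h.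
  by move=> b b'; rewrite -[b]sK -[b']sK -rmorphB !hg rmorphB.
have hM : monoid_morphism h.
  split=> [|b b']; first by rewrite -(rmorph1 g) hg rmorph1.
  by rewrite -[b]sK -[b']sK -rmorphM !hg rmorphM.
pose h' : {rmorphism B -> T} := HB.pack h
  (GRing.isZmodMorphism.Build _ _ h hB) (GRing.isMonoidMorphism.Build _ _ h hM).
by exists h'.
Qed.

End PolynomialRings.

(** * Smoothness of a localized polynomial algebra *)

Section Smoothness.
Variables (A : comNzRingType) (B : comPzRingType) (f : {rmorphism A -> B}).
Variables (n : nat) (g : {rmorphism {mpoly A[n.+1]} -> B}) (d : {mpoly A[n]}).
Hypothesis g_f : forall a, g a%:MP = f a.
Hypothesis g_surj : forall b, exists q, g q = b.
Hypothesis g_inv : g ('X_ord_max * mwiden d) = 1.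
Hypothesis g_inj : forall q, g (mwiden q) = 0 -> q * d = 0.

Let rel := 'X_ord_max * mwiden d - 1.

(** Multiplying by a power of [d] turns any polynomial, modulo [rel], into one
    without the last variable; there [g] is injective up to [d], and [d] is
    invertible modulo [rel]. *)
Lemma localization_kernel b : g b = 0 -> exists c, b = c * rel.
Proof.
have clear_denom q1 : exists N q2 c, mwiden d ^+ N * q1 = mwiden q2 + c * rel.
  move: q1; apply: mpoly_generated => [a|i|q q' [N [q2 [c E]]] [N' [q2' [c' E']]]
                                |q q' [N [q2 [c E]]] [N' [q2' [c' E']]]].
  - by exists 0%N, a%:MP, 0; rewrite expr0 mul1r mul0r addr0 mwidenC.
  - have [j ->|->] := unliftP ord_max i; last first.
      by exists 1%N, 1, 1; rewrite expr1 rmorph1 mul1r /rel addrC subrK mulrC.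
    exists 0%N, 'X_j, 0; rewrite expr0 mul1r mul0r addr0 mwidenX mnmwiden1.
    by rewrite widen_ordE.
  - exists (N + N')%N, (d ^+ N' * q2 + d ^+ N * q2').
    exists (mwiden d ^+ N' * c + mwiden d ^+ N * c').
    rewrite rmorphD !rmorphM !rmorphXn /= exprD.
    transitivity (mwiden d ^+ N' * (mwiden d ^+ N * q) +
                  mwiden d ^+ N * (mwiden d ^+ N' * q')); first by ring.
    by rewrite E E'; ring.
  - exists (N + N')%N, (q2 * q2').
    exists (c * mwiden q2' + c' * mwiden q2 + c * c' * rel).
    rewrite rmorphM /= exprD.
    transitivity ((mwiden d ^+ N * q) * (mwiden d ^+ N' * q')); first by ring.
    by rewrite E E'; ring.
have g_rel : g rel = 0 by rewrite rmorphB g_inv rmorph1 subrr.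
move: b => q gq; have [N [q2 [c E]]] := clear_denom q.
have /g_inj q2d : g (mwiden q2) = 0.
  have := congr1 g E; rewrite rmorphM gq mulr0 rmorphD rmorphM g_rel mulr0 addr0.
  by [].
pose u := 'X_ord_max * mwiden d.
exists ('X_ord_max ^+ N.+1 * mwiden d * c - (\sum_(i < N.+1) u ^+ i) * q).
have E2 : u ^+ N.+1 * q = 'X_ord_max ^+ N.+1 * mwiden d * c * rel.
  rewrite exprMn exprSr exprS.
  transitivity ('X_ord_max ^+ N * 'X_ord_max * mwiden d * (mwiden d ^+ N * q)).
    by ring.
  rewrite E mulrDr -[X in X + _ = _]mulrA -mwidenM [d * q2]mulrC q2d mwiden0.
  by rewrite -exprSr; ring.
have := subrX1 u N.+1; rewrite -/rel => E3.
transitivity (u ^+ N.+1 * q - (u ^+ N.+1 - 1) * q); first by ring.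
by rewrite E2 E3; ring.
Qed.

(** The hypotheses say that [B] is the localization of [A[x_1, ..., x_n]] at [d],
    the last variable being the inverse of [d]. Variables lift freely along a
    square-zero extension, and the inverse of the lift of [d] exists by one Newton
    step. *)
Lemma smooth_localization : smooth_rmorphism f.
Proof.
split.
  exists n.+1, g; split=> //; exists [:: rel] => q; split.
    by move=> /localization_kernel[c ->]; exists (fun=> c); rewrite big_ord1.
  case=> c ->; rewrite big_ord1 /= rmorphM rmorphB g_inv rmorph1 subrr mulr0.
  by [].
move=> T T0 r r_surj r_sq g0 h hg0.
have [x xE] := choice (fun i : 'I_n => r_surj (h (g (mwiden 'X_i)))).
have [ev [evC evX]] := mpoly_hom_exists g0 x.
have r_ev q : r (ev q) = h (g (mwiden q)).
  apply: (mpoly_hom_ext (g := r \o ev) (h := h \o g \o @mwiden n A)) => [a|i] /=.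
    by rewrite evC mwidenC g_f hg0.
  by rewrite evX xE.
have [s0 s0E] := r_surj (h (g 'X_ord_max)).
(* One Newton step: [1 - s * ev d] is the square of [1 - s0 * ev d], hence zero. *)
pose s := s0 * (1 + 1 - s0 * ev d).
have rs0 : r (s0 * ev d - 1) = 0.
  by rewrite rmorphB rmorphM s0E r_ev -!rmorphM g_inv !rmorph1 subrr.
have s_inv : s * ev d = 1.
  by have := r_sq _ _ rs0 rs0 => E; rewrite -[1]subr0 -E /s; ring.
have rs : r s = h (g 'X_ord_max).
  rewrite /s (_ : s0 * _ = s0 - s0 * (s0 * ev d - 1)); last by ring.
  by rewrite rmorphB rmorphM rs0 mulr0 subr0.
have [H [HC HX]] := mpoly_hom_exists g0 (fun i => oapp x s (unlift ord_max i)).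
have H_ev q : H (mwiden q) = ev q.
  apply: (mpoly_hom_ext (g := H \o @mwiden n A) (h := ev)) => [a|i] /=.
    by rewrite mwidenC HC evC.
  by rewrite mwidenX mnmwiden1 HX evX widen_ordE liftK.
have [|h' h'g] := hom_factor g_surj (H := H).
  move=> q /localization_kernel[c ->].
  by rewrite rmorphM rmorphB rmorphM HX unlift_none /= H_ev s_inv rmorph1 subrr mulr0.
exists h'; split=> [a|b]; first by rewrite -g_f h'g HC.
have [q <-] := g_surj b; rewrite h'g.
apply: (mpoly_hom_ext (g := r \o H) (h := h \o g)) => [a|i] /=.
  by rewrite HC g_f hg0.
rewrite HX; have [j ->|->] := unliftP ord_max i; rewrite /= ?liftK ?unlift_none //=.
by rewrite xE mwidenX mnmwiden1 widen_ordE.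
Qed.

End Smoothness.

(** * Flatness of an algebra with a basis *)

Section Flatness.
Variables (A B : comPzRingType) (f : {rmorphism A -> B}).
Variables (I : eqType) (e : I -> B) (coord : I -> B -> A).
Hypothesis coordD : forall i b b', coord i (b + b') = coord i b + coord i b'.
Hypothesis coordM : forall i a b, coord i (f a * b) = a * coord i b.
Hypothesis coordE : forall b, exists r : seq I, [/\ uniq r,
  forall i, i \notin r -> coord i b = 0 & b = \sum_(i <- r) f (coord i b) * e i].

(** Testing a tensor that dies in [N (x) B] against the balanced map
    [(y, b) |-> coord i b *: y] shows that its [i]-th coordinate, which lies in [M],
    is killed by the injection [u], hence is zero. *)
Lemma flat_basis : flat_rmorphism f.
Proof.
move=> M N u u_inj s su0 P beta [betaDl betaDr betaM].
have beta0l b : beta 0 b = 0.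
  by apply: (addrI (beta 0 b)); rewrite -betaDl !addr0.
have beta0r m : beta m 0 = 0.
  by apply: (addrI (beta m 0)); rewrite -betaDr !addr0.
have cu i : \sum_(x <- s) coord i x.2 *: x.1 = 0.
  apply: u_inj; rewrite linear0 linear_sum.
  pose bN (y : N) (b : B) : N := coord i b *: y.
  have bN_bal : balanced f bN.
    split=> [m m' b|m b b'|a m b]; rewrite /bN.
    - exact: scalerDr.
    - by rewrite coordD scalerDl.
    - by rewrite coordM !scalerA mulrC.
  have := su0 N bN bN_bal; rewrite big_map => E; rewrite -[RHS]E.
  by apply: eq_bigr => x _; rewrite linearZ.
have [r rP] := choice coordE.
pose R := undup (flatten [seq r x.2 | x <- s]).
have RE x : x \in s -> x.2 = \sum_(i <- R) f (coord i x.2) * e i.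
  move=> xs; have [r_uniq r0 {1}->] := rP x.2.
  rewrite [RHS](bigID (fun i => i \in r x.2)) /= [X in _ + X]big1 => [|i /r0 ->]; last first.
    by rewrite rmorph0 mul0r.
  rewrite addr0 -[RHS]big_filter; apply/perm_big/uniq_perm => //.
    by rewrite filter_uniq ?undup_uniq.
  move=> i; rewrite mem_filter mem_undup; case: (boolP (i \in r x.2)) => //= ir.
  by symmetry; apply/flatten_mapP; exists x.
rewrite big_seq (eq_bigr (fun x => \sum_(i <- R) beta (coord i x.2 *: x.1) (e i))).
  rewrite -big_seq exchange_big big1 // => i _.
  by rewrite -(big_morph (beta^~ (e i)) (fun m m' => betaDl m m' _) (beta0l _)) cu.
move=> x xs; rewrite {1}(RE x xs) (big_morph (beta x.1) (betaDr _) (beta0r _)).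
by apply: eq_bigr => i _; rewrite betaM.
Qed.

End Flatness.

(** * Weights of the torus action *)

Section Weights.
Variables (F : numFieldType) (p : 'I_3 -> nat).
Local Notation P := (polys F (arrow p)).

Local Notation weight := {ffun vertex p -> int}.

Definition ind_wt (q : vertex p) : weight := [ffun r => (r == q)%:Z].
Definition arrow_wt (a : arrow p) : weight :=
  ind_wt (head_of a) - ind_wt (tail_of a).
(** The torus acts on a monomial through the character with exponents [wt]: an
    arrow counts +1 at its head and -1 at its tail. *)
Definition wt (m : 'X_{1..#|arrow p|}) : weight :=
  \sum_(a : arrow p) arrow_wt a *+ m (enum_rank a).

Lemma wtD m m' : wt (m + m')%MM = wt m + wt m'.
Proof. by rewrite -big_split; apply: eq_bigr => a _; rewrite mnmDE mulrnDr. Qed.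

Lemma wt0 : wt 0%MM = 0.
Proof. by rewrite /wt big1 // => a _; rewrite mnm0E mulr0n. Qed.

Lemma wt_var a : wt U_(enum_rank a)%MM = arrow_wt a.
Proof.
rewrite /wt (bigD1 a) //= mnm1E eqxx mulr1n big1 ?addr0 // => b ab.
by rewrite mnm1E (inj_eq enum_rank_inj) eq_sym (negPf ab) mulr0n.
Qed.

Definition chr (mu : torus F p) (w : weight) : F := \prod_q sval mu q ^ w q.

Lemma chr_neq0 mu w : chr mu w != 0.
Proof. by apply/prodf_neq0 => q _; rewrite expfz_neq0 // (svalP mu). Qed.

Lemma chrD mu w w' : chr mu (w + w') = chr mu w * chr mu w'.
Proof.
rewrite -big_split; apply: eq_bigr => q _; rewrite ffunE expfzDr //.
exact: (svalP mu).
Qed.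

Lemma chr0 mu : chr mu 0 = 1.
Proof. by rewrite /chr big1 // => q _; rewrite ffunE expr0z. Qed.

Lemma chrN mu w : chr mu (- w) = (chr mu w)^-1.
Proof.
by apply: (mulfI (chr_neq0 mu w)); rewrite -chrD subrr chr0 divff ?chr_neq0.
Qed.

Lemma chrMn mu w n : chr mu (w *+ n) = chr mu w ^+ n.
Proof.
by elim: n => [|n IH]; rewrite ?mulr0n ?chr0 ?expr0 // mulrS chrD IH exprS.
Qed.

Lemma chr_ind mu q : chr mu (ind_wt q) = sval mu q.
Proof.
rewrite /chr (bigD1 q) //= ffunE eqxx expr1z big1 ?mulr1 // => r rq.
by rewrite ffunE (negPf rq) expr0z.
Qed.

(** Put 2 at one vertex and 1 elsewhere: the powers of 2 are distinct. *)
Lemma chr_separates w w' : w != w' -> exists mu, chr mu w != chr mu w'.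
Proof.
move=> ww'; have [q qww'] : exists q, w q != w' q.
  apply/existsP; apply: contraNT ww' => /existsPn H; apply/eqP/ffunP => q.
  by apply/eqP; rewrite -[_ == _]negbK; apply: H.
pose m r : F := if r == q then 2%:R else 1.
have mE r : m r != 0 by rewrite /m; case: (r == q); rewrite ?pnatr_eq0 ?oner_eq0.
exists (exist _ m mE).
have E (u : weight) : chr (exist _ m mE) u = 2%:R ^ u q.
  rewrite /chr (bigD1 q) //= {1}/m eqxx big1 ?mulr1 // => r rq.
  by rewrite /m (negPf rq) exp1rz.
rewrite !E; apply: contra_neq qww' => E2.
have [lt0 neq1] : (0 < 2%:R :> rat) * (2%:R != 1 :> rat) by [].
apply: (ieexprIz lt0 neq1); apply: (fmorph_inj (@ratr F)).
by rewrite !fmorphXz rmorph_nat.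
Qed.

Lemma act_monomial mu m :
  act_poly mu 'X_[m] = (chr mu (wt m))%:MP * 'X_[m] :> P.
Proof.
rewrite [LHS]mmapX /mmap1 mpolyX_vars.
have En : bijective (@enum_rank (arrow p)) by exact: enum_rank_bij.
rewrite (reindex _ (onW_bij _ En)) [in RHS](reindex _ (onW_bij _ En)) /=.
rewrite /wt (big_morph (chr mu) (chrD mu) (chr0 mu)) rmorph_prod -big_split.
apply: eq_bigr => a _ /=; rewrite enum_rankK chrMn rmorphXn /= -exprMn.
congr (_ ^+ _); rewrite /arrow_wt chrD chrN !chr_ind mulrAC -mpolyCM.
by rewrite [_^-1 * _]mulrC.
Qed.

Definition component (w : weight) (G : P) : P :=
  \sum_(m <- msupp G) (if wt m == w then G@_m *: 'X_[m] else 0).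

Lemma componentE w G m : (component w G)@_m = if wt m == w then G@_m else 0.
Proof.
rewrite raddf_sum /=; have [mG|mG] := boolP (m \in msupp G).
  rewrite (bigD1_seq m) //= big1 ?addr0.
    by case: ifP; rewrite ?mcoeff0 // mcoeffZ mcoeffX eqxx mulr1.
  move=> m' mm'; case: ifP; rewrite ?mcoeff0 // mcoeffZ mcoeffX (negPf mm').
  by rewrite mulr0.
rewrite (memN_msupp_eq0 mG) if_same big_seq big1 // => m' m'G.
case: ifP => _; rewrite ?mcoeff0 // mcoeffZ mcoeffX.
case: (eqVneq m' m) => [E|_]; last by rewrite mulr0.
by rewrite E (negPf mG) in m'G.
Qed.

Lemma component_is_zmod w : zmod_morphism (component w).
Proof.
move=> G H; apply/mpolyP => m; rewrite mcoeffB !componentE mcoeffB.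
by case: ifP; rewrite ?subr0.
Qed.
HB.instance Definition _ w :=
  GRing.isZmodMorphism.Build P P (component w) (component_is_zmod w).

Lemma componentZX w c m :
  component w (c *: 'X_[m]) = if wt m == w then c *: 'X_[m] else 0.
Proof.
apply/mpolyP => m'; rewrite componentE (fun_if (mcoeff m')) mcoeff0.
rewrite mcoeffZ mcoeffX; case: (eqVneq m m') => [-> //|_].
by rewrite mulr0 !if_same.
Qed.

Definition graded (w : weight) (G : P) : Prop := component w G = G.

Lemma gradedP w G : graded w G -> forall m, m \in msupp G -> wt m = w.
Proof.
move=> hG m; rewrite mcoeff_msupp -hG componentE; case: (wt m =P w) => // _.
by rewrite eqxx.
Qed.

Lemma componentM v w G H : graded v G -> component (v + w) (G * H) = G * component w H.
Proof.
move=> hG; rewrite {1}(mpolyE G) mulr_suml raddf_sum [in RHS](mpolyE G) mulr_suml.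
rewrite big_seq [RHS]big_seq; apply: eq_bigr => m mG.
have wm := gradedP hG mG; rewrite [in LHS](mpolyE H) mulr_sumr raddf_sum mulr_sumr.
apply: eq_bigr => m' _ /=; rewrite -scalerAl -scalerAr -mpolyXD scalerA componentZX.
rewrite wtD wm (inj_eq (addrI v)); case: ifP; rewrite ?mulr0 // => _.
by rewrite -scalerAl -scalerAr -mpolyXD scalerA.
Qed.

Lemma gradedM v w G H : graded v G -> graded w H -> graded (v + w) (G * H).
Proof. by move=> hG hH; rewrite /graded componentM ?hH. Qed.

Lemma gradedX m : graded (wt m) 'X_[m].
Proof. by have := componentZX (wt m) 1 m; rewrite eqxx scale1r. Qed.

Lemma graded1 : graded 0 1.
Proof. by rewrite -wt0 -mpolyX0; apply: gradedX. Qed.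

Lemma graded_var a : graded (arrow_wt a) (pvar F a).
Proof. by rewrite -wt_var; apply: gradedX. Qed.

Lemma gradedD w G H : graded w G -> graded w H -> graded w (G + H).
Proof. by move=> hG hH; rewrite /graded raddfD /= hG hH. Qed.

Lemma graded_exp w G n : graded w G -> graded (w *+ n) (G ^+ n).
Proof.
move=> hG; elim: n => [|n IH]; first exact: graded1.
by rewrite exprS mulrS; apply: gradedM.
Qed.

Lemma graded_prod (J : finType) (c : pred J) (v : J -> weight) (G : J -> P) :
  (forall j, c j -> graded (v j) (G j)) ->
  graded (\sum_(j | c j) v j) (\prod_(j | c j) G j).
Proof.
by move=> hG; apply: (big_ind2 graded) => //; [exact: graded1 | move=> *; apply: gradedM].
Qed.

Lemma act_scaled_monomial mu c m :
  act_poly mu (c *: 'X_[m]) = (chr mu (wt m))%:MP * (c *: 'X_[m]) :> P.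
Proof.
rewrite -mul_mpolyC rmorphM act_monomial mulrCA; congr (_ * _).
by rewrite [act_poly mu _]mmapC.
Qed.

Lemma act_component mu w G :
  component w (act_poly mu G) = (chr mu w)%:MP * component w G.
Proof.
rewrite (mpolyE G) rmorph_sum !(raddf_sum (component w)) mulr_sumr.
apply: eq_bigr => m _; rewrite [act_poly mu _]act_scaled_monomial mul_mpolyC scalerA.
rewrite /= !componentZX; case: eqP => [->|_]; last by rewrite mulr0.
by rewrite mul_mpolyC scalerA.
Qed.

Lemma act_graded mu w G : graded w G -> act_poly mu G = (chr mu w)%:MP * G.
Proof.
move=> hG; rewrite (mpolyE G) rmorph_sum mulr_sumr.
rewrite big_seq [RHS]big_seq; apply: eq_bigr => m /(gradedP hG) wm.
by rewrite [LHS]act_scaled_monomial wm.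
Qed.
End Weights.

(** * Paths and gauge fixing along a spanning tree *)

Lemma armP (i : 'I_3) : [\/ i = arm1, i = arm2 | i = arm3].
Proof.
by case: i => [[|[|[|//]]] ?]; [apply: Or31|apply: Or32|apply: Or33]; apply: val_inj.
Qed.

Lemma sum_arm123 (V : nmodType) (D : 'I_3 -> V) :
  \sum_i D i = D arm1 + D arm2 + D arm3.
Proof.
rewrite !big_ord_recl big_ord0 addr0 addrA.
by congr (D _ + D _ + D _); apply: val_inj.
Qed.

Definition sgn (S : comPzRingType) (i : 'I_3) : S := (-1) ^+ (i == arm2).

Lemma sgn2 S i : sgn S i * sgn S i = 1.
Proof. by rewrite /sgn; case: (i == arm2); rewrite ?expr0 ?mul1r ?expr1 ?mulrNN ?mulr1. Qed.

Lemma rmorph_sgn (S S' : comPzRingType) (h : {rmorphism S -> S'}) i :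
  h (sgn S i) = sgn S' i.
Proof. by rewrite /sgn rmorphXn rmorphN rmorph1. Qed.

Section Paths.
Variables (p : 'I_3 -> nat).

Section Values.
Variables (S : comPzRingType) (X : arrow p -> S).

Definition desc (i : 'I_3) (j : nat) : S := \prod_(l < p i | (l < j)%N) X (dn l).
Definition asc (i : 'I_3) (j : nat) : S := \prod_(l < p i | (j <= l)%N) X (up l).

Lemma desc0 i : desc i 0 = 1.
Proof. by rewrite /desc big1. Qed.

Lemma descS i (l : 'I_(p i)) : desc i l.+1 = desc i l * X (dn l).
Proof.
rewrite /desc (bigD1 l) //= mulrC; congr (_ * _); apply: eq_bigl => l'.
by rewrite ltnS [RHS]ltn_neqAle andbC.
Qed.

Lemma asc_last i : asc i (p i) = 1.
Proof. by rewrite /asc big1 // => l; rewrite leqNgt ltn_ord. Qed.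

Lemma ascS i (l : 'I_(p i)) : asc i l = X (up l) * asc i l.+1.
Proof.
rewrite /asc (bigD1 l) //=; congr (_ * _); apply: eq_bigl => l'.
by rewrite [RHS]ltn_neqAle andbC eq_sym.
Qed.

Lemma desc_all i : desc i (p i) = \prod_(l < p i) X (dn l).
Proof. by apply: eq_bigl => l; rewrite ltn_ord. Qed.

Lemma asc0 i : asc i 0 = \prod_(l < p i) X (up l).
Proof. exact: eq_bigl. Qed.
End Values.

Lemma rmorph_desc (S S' : comPzRingType) (h : {rmorphism S -> S'}) X i j :
  h (desc X i j) = desc (h \o X) i j.
Proof. by rewrite rmorph_prod. Qed.

Lemma rmorph_asc (S S' : comPzRingType) (h : {rmorphism S -> S'}) X i j :
  h (asc X i j) = asc (h \o X) i j.
Proof. by rewrite rmorph_prod. Qed.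

Lemma desc_nat_ind (Q : nat -> Prop) i :
  Q 0%N -> (forall l : 'I_(p i), Q l -> Q l.+1) -> forall j, (j <= p i)%N -> Q j.
Proof.
move=> Q0 QS; elim=> [|j IH] jp //.
exact: (QS (Ordinal jp)) (IH (ltnW jp)).
Qed.

Lemma asc_nat_ind (Q : nat -> Prop) i :
  Q (p i) -> (forall l : 'I_(p i), Q l.+1 -> Q l) -> forall j, (j <= p i)%N -> Q j.
Proof.
move=> Qp QS j /subKn <-.
apply: (@desc_nat_ind (fun n => Q (p i - n)%N) i); last exact: leq_subr.
  by rewrite subn0.
move=> l; have /= := QS (rev_ord l).
by rewrite subnSK.
Qed.

Lemma tail_dn i (l : 'I_(p i)) : tail_of (dn l) = xvert p i l. Proof. by []. Qed.
Lemma head_dn i (l : 'I_(p i)) : head_of (dn l) = xvert p i l.+1. Proof. by []. Qed.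
Lemma tail_up i (l : 'I_(p i)) : tail_of (up l) = xvert p i l.+1. Proof. by []. Qed.
Lemma head_up i (l : 'I_(p i)) : head_of (up l) = xvert p i l. Proof. by []. Qed.

Lemma arrow_ind (Q : arrow p -> Prop) :
  (forall i (l : 'I_(p i)), Q (dn l)) -> (forall i (l : 'I_(p i)), Q (up l)) ->
  forall a, Q a.
Proof. by move=> Qd Qu [[i l] []]; [apply: Qd | apply: Qu]. Qed.

Lemma xvert_interior i (l : 'I_(p i).-1) :
  xvert p i l.+1 = inl (Tagged (fun i => 'I_(p i).-1) l).
Proof. by rewrite /xvert valK. Qed.

Lemma last_index i j : (j < p i)%N -> ((p i).-1 <= j)%N -> j.+1 = p i.
Proof. lia. Qed.

Section Tree.
Hypothesis hp : forall i, (1 < p i)%N.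
Variables (k o o' : 'I_3) (c : nat).
Hypotheses (ok : o != k) (o'k : o' != k) (oo' : o != o') (cp : (c < p k)%N).

Lemma arm_cases i : [\/ i = k, i = o | i = o'].
Proof.
move: k o o' ok o'k oo' i.
move=> [[|[|[|//]]] ?] [[|[|[|//]]] ?] [[|[|[|//]]] ?] //= _ _ _ [[|[|[|//]]] ?];
  by [apply: Or31; apply: val_inj | apply: Or32; apply: val_inj
     | apply: Or33; apply: val_inj].
Qed.

(** A spanning tree rooted at the top vertex: arms [o] and [o'] are descended,
    but for the last arrow of [o'], and arm [k] is descended to its [c]-th vertex
    and climbed from the bottom to its [c+1]-st. *)
Definition tree (a : arrow p) : bool :=
  let: (existT i l, down) := a in
  if i == k then (if down then (l < c)%N else (c < l)%N)
  else down && ((i == o) || (l.+1 < p i)%N).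

Section TreeValues.
Variables (S : comPzRingType) (X : arrow p -> S).

Definition tree_path (q : vertex p) : S :=
  match q with
  | inl (existT i l) =>
      if (i == k) && (c < l.+1)%N then desc X o (p o) * asc X i l.+1 else desc X i l.+1
  | inr is_top => if is_top then 1 else desc X o (p o)
  end.

Lemma tree_path_desc i j : (j <= p i)%N ->
  (if i == k then (j <= c)%N else (i == o) || (j < p i)%N) ->
  tree_path (xvert p i j) = desc X i j.
Proof.
case: j => [|j] jp cond; first by rewrite /= desc0.
have [ji|ji] := ltnP j (p i).-1.
  rewrite (xvert_interior (Ordinal ji)) /=.
  by move: cond; case: (i == k) => //= jc; rewrite ltnNge jc.
have E := last_index jp ji.
rewrite E xvert_last //=; move: cond; rewrite E ltnn orbF.
case: (eqVneq i k) => [->|_ /eqP -> //].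
by rewrite leqNgt cp.
Qed.

Lemma tree_path_asc j : (c < j)%N -> (j <= p k)%N ->
  tree_path (xvert p k j) = desc X o (p o) * asc X k j.
Proof.
case: j => [//|j] cj jp.
have [ji|ji] := ltnP j (p k).-1.
  by rewrite (xvert_interior (Ordinal ji)) /= eqxx cj.
by rewrite (last_index jp ji) xvert_last // asc_last mulr1.
Qed.

Lemma tree_path_step a : tree a ->
  tree_path (head_of a) = tree_path (tail_of a) * X a.
Proof.
elim/arrow_ind: a => i l; rewrite /tree /=.
  rewrite head_dn tail_dn; case: (eqVneq i k) => [E|ik].
    move: l; rewrite E => l lc.
    rewrite !tree_path_desc ?eqxx ?descS //; [exact: ltnW | exact: ltnW].
  move=> cond; rewrite !tree_path_desc ?descS ?(negPf ik) ?ltn_ord ?orbT //.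
  exact: ltnW.
rewrite head_up tail_up; case: (eqVneq i k) => // E.
move: l; rewrite E => l cl.
rewrite !tree_path_asc //; last exact: ltnW; last exact: ltnW.
by rewrite ascS -mulrA [X _ * _]mulrC.
Qed.

Variable Y : vertex p -> S.
Hypothesis Y_inv : forall q, tree_path q * Y q = 1.

(** [Y q] being the inverse of [tree_path q], this is the value of [a] after the
    change of basis at every vertex that makes all tree arrows equal to 1. *)
Definition gauge (a : arrow p) : S := tree_path (tail_of a) * X a * Y (head_of a).

Lemma gauge_tree a : tree a -> gauge a = 1.
Proof. by move=> /tree_path_step; rewrite /gauge => <-. Qed.

Lemma gauge_pair i (l : 'I_(p i)) :
  gauge (dn l) * gauge (up l) = X (dn l) * X (up l).
Proof.
rewrite /gauge head_dn tail_dn head_up tail_up.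
transitivity (X (dn l) * X (up l) * (tree_path (xvert p i l) * Y (xvert p i l)) *
  (tree_path (xvert p i l.+1) * Y (xvert p i l.+1))); first by ring.
by rewrite !Y_inv !mulr1.
Qed.

Lemma Y_top : Y top = 1.
Proof. by rewrite -[LHS]mul1r; exact: (Y_inv top). Qed.

Lemma gauge_desc i j : (j <= p i)%N -> desc gauge i j = desc X i j * Y (xvert p i j).
Proof.
apply: (desc_nat_ind (Q := fun j => desc gauge i j = desc X i j * Y (xvert p i j))).
  by rewrite !desc0 /= Y_top mulr1.
move=> l IH; rewrite !descS IH /gauge head_dn tail_dn.
transitivity (desc X i l * X (dn l) * Y (xvert p i l.+1) *
  (tree_path (xvert p i l) * Y (xvert p i l))); first by ring.
by rewrite Y_inv mulr1.
Qed.

Lemma gauge_other_bottom :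
  desc X o' (p o') * Y bottom = gauge (dn (alast hp o')).
Proof.
rewrite -(xvert_last hp o') -gauge_desc // -[in LHS](prednK (ltnW (hp o'))).
rewrite (descS gauge (alast hp o')) [desc _ _ _]big1 ?mul1r // => l lp.
apply: gauge_tree => /=; rewrite (negPf o'k) /= orbC.
by rewrite -ltn_predRL lp.
Qed.

Lemma gauge_cut_bottom (lc : 'I_(p k)) : lc = c :> nat ->
  desc X k (p k) * Y bottom =
  gauge (dn lc) * \prod_(l < p k | (c < l)%N) (X (dn l) * X (up l)).
Proof.
move=> lcE; rewrite -(xvert_last hp k) -gauge_desc // desc_all (bigD1 lc) //=.
congr (_ * _); rewrite (bigID (fun l : 'I_(p k) => (c < l)%N)) /= mulrC big1 ?mul1r.
  apply: eq_big => [l|l /andP[_ cl]].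
    by rewrite andb_idl // => cl; apply: contraTneq cl => ->; rewrite lcE ltnn.
  by rewrite -gauge_pair [gauge (up l)]gauge_tree ?mulr1 //= eqxx.
move=> l /andP[llc cl]; apply: gauge_tree; rewrite /= eqxx ltn_neqAle leqNgt cl.
by rewrite -lcE val_eqE llc.
Qed.

End TreeValues.
End Tree.
End Paths.

(** * Semi-invariants *)

Section Sections.
Variables (p : 'I_3 -> nat).
Hypothesis hp : forall i, (1 < p i)%N.
Local Notation weight := {ffun vertex p -> int}.

Definition theta_wt : weight := \sum_(q | q != top) (ind_wt q - ind_wt top).

(** [theta0] is the weight of a product of one path from the top to each of the
    other vertices. *)
Lemma theta_wtE q : theta_wt q = theta0 q.
Proof.
rewrite /theta_wt sum_ffunE /theta0; have [->|qt] := eqVneq q top.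
  rewrite (eq_bigr (fun=> -1)); last first.
    by move=> r rt; rewrite !ffunE eqxx eq_sym (negPf rt) sub0r.
  rewrite sumr_const mulNrn; congr (- _); rewrite -[1 *+ _]/(_%:R) natz; congr Posz.
  rewrite -[LHS]/(#|predC1 (top : vertex p)|) cardC1 card_sum card_bool addn2 /=.
  rewrite card_tagged sumnE big_map big_enum /= addn1; congr _.+1.
  by apply: eq_bigr => i _; rewrite card_ord.
rewrite (bigD1 q) //= !ffunE eqxx (negPf qt) subr0 big1 ?addr0 // => r /andP[_ rq].
by rewrite !ffunE eq_sym (negPf rq) (negPf qt).
Qed.

Section Gauge.
Variables (k o o' : 'I_3) (c : nat).
Variables (S : comPzRingType) (X : arrow p -> S) (Y : vertex p -> S).
Local Notation tau := (tree_path k o c X).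
Hypothesis Y_inv : forall q, tau q * Y q = 1.

(** Regrouping by vertex, [tree_path q] occurs as often as arrows leave [q] and its
    inverse as often as arrows enter [q]; the difference is the weight at [q]. *)
Lemma gauge_monomial (e : arrow p -> nat) N :
  \sum_a arrow_wt a *+ e a = theta_wt *+ N ->
  \prod_a gauge k o c X Y a ^+ e a =
  \prod_a X a ^+ e a * (\prod_(q | q != top) Y q) ^+ N.
Proof.
move=> e_wt.
pose out q := (\sum_(a : arrow p | tail_of a == q) e a)%N.
pose inn q := (\sum_(a : arrow p | head_of a == q) e a)%N.
have Eio q : (inn q)%:Z = (out q)%:Z + theta0 q *+ N.
  rewrite -theta_wtE -ffunMnE -e_wt sum_ffunE /inn /out -!natz !natr_sum.
  rewrite [X in X = _]big_mkcond [X in _ = X + _]big_mkcond -big_split.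
  apply: eq_bigr => a _; rewrite /= ffunMnE !ffunE [q == head_of _]eq_sym.
  rewrite [q == tail_of _]eq_sym.
  by case: eqP; case: eqP => _ _; rewrite ?subrr ?mul0rn ?subr0 ?sub0r ?addr0 //;
    rewrite ?add0r ?mulNrn ?subrr ?addrN.
have regroup (Z : vertex p -> S) (end_of : arrow p -> vertex p) :
    \prod_a Z (end_of a) ^+ e a = \prod_q Z q ^+ (\sum_(a | end_of a == q) e a).
  rewrite (partition_big end_of xpredT) //=; apply: eq_bigr => q _.
  by rewrite expr_sum; apply: eq_bigr => a /eqP ->.
rewrite (eq_bigr (fun a => X a ^+ e a * (tau (tail_of a) ^+ e a * Y (head_of a) ^+ e a))).
  rewrite !big_split /= !regroup -big_split /=; congr (_ * _).
  rewrite (bigD1 top) //= (Y_top Y_inv) expr1n mul1r expr1n mul1r -prodrXl.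
  apply: eq_bigr => q qt; move: (Eio q); rewrite /theta0 (negPf qt) natz -PoszD.
  by case=> Eq; rewrite -/(inn q) -/(out q) Eq exprD mulrA -exprMn Y_inv expr1n mul1r.
by move=> a _; rewrite /gauge !exprMn mulrCA -mulrA.
Qed.
End Gauge.

(** A product of two paths from the top to every other vertex, hence of weight
    [2 theta0]. The two paths to the bottom descend [o] and [o'], so that both
    [D_o] and [D_o'] become invertible where the section does; one tree would only
    invert one of them. *)
Definition chart_section (k o o' : 'I_3) (c : nat) (S : comPzRingType)
    (X : arrow p -> S) : S :=
  desc X o' (p o') * desc X o (p o) *
  (\prod_(q | (q != top) && (q != bottom)) tree_path k o c X q) ^+ 2.

Section SectionUnits.
Variables (k o o' : 'I_3) (c : nat) (S : comPzRingType) (X : arrow p -> S).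
Local Notation tau := (tree_path k o c X).
Local Notation sec := (chart_section k o o' c X).

Lemma prod_not_top (Z : vertex p -> S) : \prod_(q | q != top) Z q =
  Z bottom * \prod_(q | (q != top) && (q != bottom)) Z q.
Proof. by rewrite (bigD1 bottom). Qed.

Lemma chart_section_bottom :
  sec * tau bottom = desc X o' (p o') * (\prod_(q | q != top) tau q) ^+ 2.
Proof. by rewrite prod_not_top /chart_section /=; ring. Qed.

Lemma tree_path_dvd q : exists d, tau q * d = sec.
Proof.
case: (eqVneq q top) => [->|qt]; first by exists sec; rewrite mul1r.
case: (eqVneq q bottom) => [->|qb].
  by eexists; rewrite /chart_section [desc X o' _ * _]mulrC -mulrA; reflexivity.
rewrite /chart_section (bigD1 q) ?qt //= expr2.
set R := \prod_(r | _) _.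
exists (desc X o' (p o') * desc X o (p o) * R * (tau q * R)); ring.
Qed.

Lemma other_path_dvd : exists d, desc X o' (p o') * d = sec.
Proof. by eexists; rewrite /chart_section -mulrA; reflexivity. Qed.
End SectionUnits.

Section Naturality.
Variables (k o o' : 'I_3) (c : nat) (S S' : comPzRingType) (h : {rmorphism S -> S'}).

Lemma rmorph_tree_path (X : arrow p -> S) q :
  h (tree_path k o c X q) = tree_path k o c (h \o X) q.
Proof.
case: q => [[i l]|[]] /=; rewrite ?rmorph1 ?rmorph_desc //.
by rewrite (fun_if h) rmorphM !rmorph_desc rmorph_asc.
Qed.

Lemma rmorph_chart_section (X : arrow p -> S) :
  h (chart_section k o o' c X) = chart_section k o o' c (h \o X).
Proof.
rewrite /chart_section rmorphM rmorphXn rmorph_prod rmorphM !rmorph_desc.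
by congr (_ * _ ^+ _); apply: eq_bigr => q _; apply: rmorph_tree_path.
Qed.
End Naturality.
End Sections.

Section SemiInvariants.
Variables (F : numFieldType) (p : 'I_3 -> nat).
Hypothesis hp : forall i, (1 < p i)%N.
Local Notation weight := {ffun vertex p -> int}.
Local Notation P := (polys F (arrow p)).
Local Notation var := (@pvar F (arrow p)).

Lemma graded_desc i j : (j <= p i)%N ->
  graded (ind_wt (xvert p i j) - ind_wt top) (desc var i j).
Proof.
apply: (desc_nat_ind (Q := fun j => graded (ind_wt (xvert p i j) - ind_wt top) _)).
  by rewrite subrr desc0; apply: graded1.
move=> l IH; rewrite descS; have := gradedM IH (graded_var F (dn l)).
by rewrite /arrow_wt head_dn tail_dn addrCA addrAC subrr add0r addrC.
Qed.

Lemma graded_asc i j : (j <= p i)%N ->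
  graded (ind_wt (xvert p i j) - ind_wt bottom) (asc var i j).
Proof.
apply: (asc_nat_ind (Q := fun j => graded (ind_wt (xvert p i j) - ind_wt bottom) _)).
  by rewrite xvert_last // subrr asc_last; apply: graded1.
move=> l IH; rewrite ascS; have := gradedM (graded_var F (up l)) IH.
by rewrite /arrow_wt head_up tail_up addrA subrK.
Qed.

Lemma graded_tree_path k o c q :
  graded (ind_wt q - ind_wt top) (tree_path k o c var q).
Proof.
case: q => [[i l]|[]] /=; last 2 first.
- by rewrite subrr; apply: graded1.
- by have := graded_desc (leqnn (p o)); rewrite xvert_last.
have lp : (l.+1 <= p i)%N by rewrite (leq_trans (ltn_ord l)) ?leq_pred.
rewrite -xvert_interior; case: ifP => _; last exact: graded_desc.
have := gradedM (graded_desc (leqnn (p o))) (graded_asc lp).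
by rewrite xvert_last // addrC addrA subrK.
Qed.

Lemma rep_relE : rep_rel F p = \sum_i sgn P i * desc var i (p i).
Proof.
by rewrite sum_arm123 /sgn /= expr0 expr1 !mul1r mulN1r /rep_rel /Dpath !desc_all.
Qed.

Lemma graded_const w (a : F) (G : P) : graded w G -> graded w (a%:MP * G).
Proof.
by move=> hG; rewrite -[w]add0r -[a%:MP]mulr1 mul_mpolyC; apply: gradedM => //;
  rewrite -mpolyX0 -(@wt0 p) /graded componentZX eqxx.
Qed.

Lemma graded_rep_rel : graded (ind_wt bottom - ind_wt top) (rep_rel F p).
Proof.
rewrite rep_relE; apply: (big_ind (graded _)) => [|G H|i _].
- by rewrite /graded raddf0.
- exact: gradedD.
- rewrite -(rmorph_sgn (@mpolyC #|arrow p| F)); apply: graded_const.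
  by have := graded_desc (leqnn (p i)); rewrite xvert_last.
Qed.

Lemma graded_chart_section k o o' c :
  graded (theta_wt p *+ 2) (chart_section k o o' c var).
Proof.
have D i : graded (ind_wt bottom - ind_wt top) (desc var i (p i)).
  by have := graded_desc (leqnn (p i)); rewrite xvert_last.
rewrite /theta_wt (bigD1 bottom) //= mulrnDl [X in X + _]mulr2n.
apply: gradedM; first exact: gradedM.
by apply/graded_exp/graded_prod => q _; apply: graded_tree_path.
Qed.

Local Notation proj := (repProj F hp).

Lemma proj_eq0 (G : P) : proj G = 0 <-> exists H, G = H * rep_rel F p.
Proof.
split=> [/gproj_eq0[H ->]|[H ->]].
  by exists (H 0%N); rewrite big_ord1.
by apply/gproj_eq0; exists (fun=> H); rewrite big_ord1.
Qed.

(** The defining ideal is graded, so a relation modulo the ideal holds in each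
    weight separately. If [mu . G = chr mu w * G] near [f], then the component of
    any other weight [w'] is killed by [chr mu w' - chr mu w], which is a nonzero
    scalar for a suitable [mu]. *)
Lemma semi_invariant_component (f G : P) (v w : weight) : graded v f ->
  (forall mu, exists m, proj f ^+ m *
    (torus_act hp mu (proj G) - repC F hp (chr mu w) * proj G) = 0) ->
  exists m, proj f ^+ m * (proj G - proj (component w G)) = 0.
Proof.
move=> hf hG; pose tors g := exists m, proj f ^+ m * proj g = 0.
have torsD g g' : tors g -> tors g' -> tors (g + g').
  move=> [m E] [m' E']; exists (m + m')%N; rewrite rmorphD exprD mulrDr.
  by rewrite -mulrA mulrCA E mulr0 -mulrA E' mulr0 addr0.
have tors_comp w' : w' != w -> tors (component w' G).
  move=> w'w; have [mu chrw] := chr_separates F w'w; have [m E] := hG mu.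
  exists m; have : proj (f ^+ m * (act_poly mu G - (chr mu w)%:MP * G)) = 0.
    move: E; rewrite act_proj => <-.
    by rewrite (rmorphM proj) (rmorphXn proj) (rmorphB proj) (rmorphM proj).
  move=> /proj_eq0[H /(congr1 (component (v *+ m + w')))].
  rewrite (componentM _ _ (graded_exp m hf)) raddfB /= act_component.
  have -> : component w' ((chr mu w)%:MP * G) = (chr mu w)%:MP * component w' G.
    by rewrite -[in LHS](add0r w') componentM //; rewrite -[_%:MP]mulr1;
       apply: graded_const; apply: graded1.
  rewrite -mulrBl -mpolyCB mulrCA => E2; rewrite -(rmorphXn proj) -rmorphM.
  apply/proj_eq0; set u := chr mu w' - chr mu w in E2.
  have u0 : u != 0 by rewrite subr_eq0.
  exists (u^-1%:MP * component (v *+ m + w' - (ind_wt bottom - ind_wt top)) H).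
  rewrite -mulrA [component _ H * _]mulrC -(componentM _ _ graded_rep_rel).
  rewrite [ind_wt bottom - _ + _]addrC subrK [_ * H]mulrC -E2 !mulrA.
  by rewrite -mpolyCM mulVf // mpolyC1 mul1r.
suff [m E] : tors (G - component w G) by exists m; rewrite -rmorphB.
pose ws := undup [seq wt m | m <- msupp G].
have -> : G - component w G = \sum_(w' <- ws | w' != w) component w' G.
  apply/mpolyP => m; rewrite mcoeffB componentE raddf_sum /=.
  rewrite (eq_bigr (fun w' => if wt m == w' then G@_m else 0)); last first.
    by move=> w' _; rewrite componentE.
  have [mG|mG] := boolP (m \in msupp G); last first.
    rewrite (memN_msupp_eq0 mG) if_same subr0 big1 // => w' _.
    by rewrite if_same.
  have mws : wt m \in ws by rewrite mem_undup map_f.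
  rewrite big_mkcond (bigD1_seq (wt m)) ?undup_uniq //= eqxx big1 ?addr0.
    by case: (wt m == w); rewrite ?subrr ?subr0.
  by move=> w' /negPf w'm; rewrite [wt m == _]eq_sym w'm if_same.
apply: (big_ind tors) => [|//|w' /tors_comp //].
by exists 0%N; rewrite rmorph0 mulr0.
Qed.
End SemiInvariants.

(** * The slice of a chart *)

Section Slice.
Variables (p : 'I_3 -> nat).
Hypothesis hp : forall i, (1 < p i)%N.
Variables (k o o' : 'I_3) (c : nat).
Hypotheses (ok : o != k) (o'k : o' != k) (oo' : o != o') (cp : (c < p k)%N).

Lemma is_main_arm i : i != k -> i != o' -> i == o.
Proof.
by case: (arm_cases ok o'k oo' i) => ->; rewrite ?eqxx.
Qed.

Lemma is_other_arm i : i != k -> i != o -> i = o'.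
Proof.
by case: (arm_cases ok o'k oo' i) => ->; rewrite ?eqxx.
Qed.

Section Values.
Variables (S : comPzRingType) (L : 'I_3 -> nat -> S) (x y s : S).

Local Notation sgn := (sgn S).

Lemma sum_arms (D : 'I_3 -> S) : \sum_i D i = D k + D o + D o'.
Proof.
rewrite (bigD1 k) //= (bigD1 o) ?ok //= (bigD1 o') /=; last first.
  by rewrite o'k eq_sym oo'.
rewrite big1 ?addr0 ?addrA // => i /andP[/andP[ik io] io'].
by case: (arm_cases ok o'k oo' i) ik io io' => ->; rewrite eqxx.
Qed.

Definition slice_v i l : S := x * y - L k c + L i l.

Definition slice_delta : S :=
  - sgn o' * (sgn o + sgn k * (x * \prod_(l < p k | (c < l)%N) slice_v k l)).

(** The representation in which the tree arrows are 1, the two arrows at the cut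
    are the free parameters [x] and [y], and the cycles have prescribed
    differences [L]. Each cycle off the cut contains a tree arrow, so its other
    arrow is the value of the cycle; the exception is the last cycle of arm [o'],
    whose descending arrow is forced by the relation and whose ascending arrow
    thus needs the inverse [s] of [slice_delta]. *)
Definition slice (a : arrow p) : S :=
  let: (existT i l, down) := a in
  if tree k o c a then 1
  else if (i == k) && (l == c :> nat) then (if down then x else y)
  else if (i == o') && (l.+1 == p i) then (if down then slice_delta else slice_v i l * s)
  else slice_v i l.

Hypothesis s_delta : slice_delta * s = 1.

Lemma slice_tree a : tree k o c a -> slice a = 1.
Proof. by case: a => [[i l] d]; rewrite /slice => ->. Qed.

Lemma slice_pair i (l : 'I_(p i)) : slice (dn l) * slice (up l) = slice_v i l.
Proof.
have ko' : (k == o') = false by rewrite eq_sym (negPf o'k).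
have o'o : (o' == o) = false by rewrite eq_sym (negPf oo').
rewrite /slice /tree /=; case: (eqVneq i k) => [ik|ik] /=.
  move: l; rewrite ik ko' /= => l.
  case: (ltngtP l c) => [lc|lc|lc]; rewrite ?mul1r ?mulr1 //.
  by rewrite /slice_v lc subrK.
case: (eqVneq i o') => [io'|io'] /=; last first.
  by rewrite (is_main_arm ik io') mul1r.
move: l; rewrite io' o'o /= => l.
have [lp|] := ltnP l.+1 (p o'); first by rewrite (ltn_eqF lp) mul1r.
move=> pl; have -> : l.+1 == p o' by rewrite eqn_leq ltn_ord.
by rewrite mulrCA s_delta mulr1.
Qed.

Section GaugeIsSlice.
Variables (t : S) (X : arrow p -> S) (Y : vertex p -> S).
Hypothesis Y_inv : forall q, tree_path k o c X q * Y q = 1.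
Hypothesis Xv : forall i (l : 'I_(p i)), X (dn l) * X (up l) = t + L i l.
Hypothesis Xrel : \sum_i sgn i * desc X i (p i) = 0.
Hypothesis xE : x = gauge k o c X Y (dn (Ordinal cp)).
Hypothesis yE : y = gauge k o c X Y (up (Ordinal cp)).

Lemma cycle_slice i (l : 'I_(p i)) : X (dn l) * X (up l) = slice_v i l.
Proof. by rewrite /slice_v xE yE gauge_pair // !Xv /=; ring. Qed.

(** After gauging, [D_o = 1] and [D_o'] is its own last arrow, so the relation
    solves for that arrow in terms of [D_k]. *)
Lemma gauge_delta : gauge k o c X Y (dn (alast hp o')) = slice_delta.
Proof.
have := congr1 (fun z => - sgn o' * (z * Y bottom)) Xrel.
rewrite mul0r mulr0 sum_arms !mulrDl -!mulrA.
rewrite (gauge_cut_bottom hp cp Y_inv (lc := Ordinal cp) erefl) -xE.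
rewrite (gauge_other_bottom hp o'k cp Y_inv) (Y_inv bottom).
under [in X in X -> _]eq_bigr do rewrite cycle_slice.
move=> E; rewrite -[LHS]mul1r -(sgn2 S o') -[LHS]addr0 -[X in _ + X]E /slice_delta.
by ring.
Qed.

(** Every representation on which the section is invertible is thus equivalent to
    one in the slice, which is what identifies the chart. *)
Lemma gauge_slice : gauge k o c X Y =1 slice.
Proof.
have ko' : (k == o') = false by rewrite eq_sym (negPf o'k).
have o'o : (o' == o) = false by rewrite eq_sym (negPf oo').
move=> a; have [ta|ta] := boolP (tree k o c a).
  by rewrite (gauge_tree hp cp Y_inv ta) slice_tree.
have pair_tree i (l : 'I_(p i)) : gauge k o c X Y (dn l) * gauge k o c X Y (up l) =
  slice_v i l by rewrite gauge_pair ?cycle_slice.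
elim/arrow_ind: a ta => i l ta; rewrite /slice (negPf ta) /=; move: ta; rewrite /tree /=.
  case: (eqVneq i k) => [ik|ik] /=.
    move: l; rewrite ik ko' /= => l; case: (ltngtP l c) => // lc _.
      by rewrite -pair_tree [gauge _ _ _ _ _ (up l)]gauge_tree ?mulr1 //= eqxx.
    by rewrite xE; congr (gauge _ _ _ _ _ (dn _)); apply: val_inj.
  rewrite negb_or -leqNgt => /andP[io pl].
  have io' := is_other_arm ik io.
  move: l pl {ik io}; rewrite io' => l pl.
  have lp : l.+1 == p o' by rewrite eqn_leq ltn_ord.
  rewrite eqxx lp /= -gauge_delta; congr (gauge _ _ _ _ _ (dn _)); apply: val_inj => /=.
  exact: (congr1 predn (eqP lp)).
case: (eqVneq i k) => [ik|ik] /=.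
  move: l; rewrite ik ko' /= => l; case: (ltngtP l c) => // lc _.
    by rewrite -pair_tree [gauge _ _ _ _ _ (dn l)]gauge_tree ?mul1r //= eqxx.
  by rewrite yE; congr (gauge _ _ _ _ _ (up _)); apply: val_inj.
move=> _; case: ifP => [/andP[/eqP io' lp]|olast]; last first.
  rewrite -pair_tree [gauge _ _ _ _ _ (dn l)]gauge_tree ?mul1r //=.
  rewrite (negPf ik); move: olast; case: (eqVneq i o') => [_ /= olast|/(is_main_arm ik) ->] //.
  by rewrite ltn_neqAle olast ltn_ord orbT.
move: l lp; rewrite io' => l lp; rewrite -pair_tree.
have -> : gauge k o c X Y (dn l) = slice_delta.
  rewrite -gauge_delta; congr (gauge _ _ _ _ _ (dn _)); apply: val_inj => /=.
  exact: (congr1 predn (eqP lp)).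
by rewrite mulrAC s_delta mul1r.
Qed.
End GaugeIsSlice.

Lemma slice_desc_other i : i != k -> desc slice i (p i) = if i == o' then slice_delta else 1.
Proof.
have o'o : (o' == o) = false by rewrite eq_sym (negPf oo').
move=> ik; rewrite desc_all; case: eqP => [io'|/eqP io']; last first.
  rewrite big1 // => l _; apply: slice_tree.
  by rewrite /= (negPf ik) (is_main_arm ik io').
rewrite io' (bigD1 (alast hp o')) // big1 ?mulr1.
  have lastK : (p o').-1.+1 = p o' by rewrite prednK // ltnW.
  by rewrite /= mulr1 (negPf o'k) o'o lastK ltnn !eqxx.
move=> l ll; apply: slice_tree; rewrite /= (negPf o'k) ltn_neqAle ltn_ord andbT.
rewrite orbC; apply/orP; left; apply: contraNneq ll => E.
by apply/eqP/val_inj/(congr1 predn E).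
Qed.

Lemma slice_desc_cut : desc slice k (p k) =
  x * \prod_(l < p k | (c < l)%N) slice_v k l.
Proof.
have ko' : (k == o') = false by rewrite eq_sym (negPf o'k).
rewrite desc_all (bigD1 (Ordinal cp)) //= !eqxx ltnn /=; congr (_ * _).
rewrite (bigID (fun l : 'I_(p k) => (c < l)%N)) /= [X in _ * X]big1 ?mulr1.
  apply: eq_big => [l|l /andP[_ cl]].
    by rewrite andb_idl // => cl; apply: contraTneq cl => ->; rewrite ltnn.
  by rewrite ltnNge (ltnW cl) (gtn_eqF cl) ko'.
move=> l /andP[llc cl]; rewrite ltn_neqAle leqNgt cl andbT.
by move: llc; rewrite -val_eqE /= => ->.
Qed.

Lemma slice_relation : \sum_i sgn i * desc slice i (p i) = 0.
Proof.
have o'o : (o == o') = false by rewrite (negPf oo').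
rewrite sum_arms slice_desc_cut !slice_desc_other // o'o eqxx mulr1 /slice_delta.
rewrite [sgn o' * (_ * _)]mulrA mulrN sgn2; ring.
Qed.

Lemma slice_tree_path q : tree_path k o c slice q = 1.
Proof.
have D0 : desc slice o (p o) = 1 by rewrite slice_desc_other // (negPf oo').
case: q => [[i l]|[]] //=.
have lp : (l.+1 < p i)%N by rewrite -ltn_predRL.
case: ifP => [/andP[ik cl]|ncond].
  rewrite D0 mul1r /asc big1 // => l' ll'; apply: slice_tree.
  by rewrite /= ik (leq_trans cl).
rewrite /desc big1 // => l' ll'; apply: slice_tree; rewrite /=.
move: ncond; case: (i == k) => /= [|_]; last by rewrite (leq_ltn_trans ll' lp) orbT.
by move=> /negbT; rewrite -leqNgt; apply: leq_trans.
Qed.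

Lemma slice_chart_section : chart_section k o o' c slice = slice_delta.
Proof.
rewrite /chart_section !slice_desc_other // eqxx (negPf oo') mulr1.
by rewrite big1 ?expr1n ?mulr1 // => q _; apply: slice_tree_path.
Qed.
End Values.

Section Naturality.
Variables (S S' : comPzRingType) (h : {rmorphism S -> S'}).
Variables (L : 'I_3 -> nat -> S) (x y s : S).

Lemma rmorph_slice_v i l :
  h (slice_v L x y i l) = slice_v (fun i l => h (L i l)) (h x) (h y) i l.
Proof. by rewrite rmorphD rmorphB rmorphM. Qed.

Lemma rmorph_slice_delta :
  h (slice_delta L x y) = slice_delta (fun i l => h (L i l)) (h x) (h y).
Proof.
rewrite /slice_delta rmorphM rmorphN rmorphD !rmorphM !rmorph_sgn rmorph_prod.
by under eq_bigr do rewrite rmorph_slice_v.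
Qed.

Lemma rmorph_slice a :
  h (slice L x y s a) = slice (fun i l => h (L i l)) (h x) (h y) (h s) a.
Proof.
case: a => [[i l] d]; rewrite /slice; case: ifP; rewrite ?rmorph1 //.
case: ifP => // _ _; first by case: d.
by case: ifP; case: d; rewrite ?rmorph_slice_delta ?rmorphM ?rmorph_slice_v.
Qed.
End Naturality.
End Slice.

(** * Localizations and the points of Delta *)

Section Localizations.
Variables (R : comNzRingType) (f : R).

Definition loc_of (g : R) : loc f := frac f g 0.

Fact loc_of_zmod : zmod_morphism loc_of.
Proof. by move=> g h; rewrite /loc_of fracB !expr0 !mulr1. Qed.
Fact loc_of_monoid : monoid_morphism loc_of.
Proof. by split=> [//|g h]; rewrite /loc_of fracM. Qed.
HB.instance Definition _ := GRing.isZmodMorphism.Build R (loc f) loc_of loc_of_zmod.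
HB.instance Definition _ := GRing.isMonoidMorphism.Build R (loc f) loc_of loc_of_monoid.

Lemma frac_exp g m : frac f g m = loc_of g * frac f 1 1 ^+ m.
Proof.
elim: m => [|m IH]; first by rewrite expr0 mulr1.
by rewrite exprSr mulrA -IH fracM mulr1 addn1.
Qed.

Lemma loc_of_inv : loc_of f * frac f 1 1 = 1.
Proof. by rewrite fracM mulr1 -frac10; apply: frac_eqE; rewrite mul1r mulr1. Qed.

Lemma loc_lift (S : comPzRingType) (h : {rmorphism R -> S}) (e : S) :
  h f * e = 1 -> exists H : {rmorphism loc f -> S}, forall g, H (loc_of g) = h g.
Proof.
move=> hfe; pose H (z : loc f) := h (repr z).1 * e ^+ (repr z).2.
have inv_exp m : h f ^+ m * e ^+ m = 1 by rewrite -exprMn hfe expr1n.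
have HE g m : H (frac f g m) = h g * e ^+ m.
  rewrite /H; have: frac f (repr (frac f g m)).1 (repr (frac f g m)).2 = frac f g m.
    by rewrite /frac -surjective_pairing reprK.
  move: (repr _).1 (repr _).2 => g' m' /frac_eq[N /(congr1 h)].
  rewrite rmorphM rmorphB !rmorphM !rmorphXn rmorph0 => E.
  transitivity (h g * e ^+ m + (h f ^+ N * (h g' * h f ^+ m - h g * h f ^+ m')) *
     (e ^+ N * e ^+ m * e ^+ m')); last by rewrite E mul0r addr0.
  transitivity (h g * e ^+ m + (h f ^+ N * e ^+ N) * (h g' * (h f ^+ m * e ^+ m) *
    e ^+ m' - h g * e ^+ m * (h f ^+ m' * e ^+ m'))); last by ring.
  by rewrite !inv_exp !mulr1 mul1r addrC subrK.
have HB : zmod_morphism H.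
  move=> z w; have [g [m ->]] := frac_surj z; have [g' [m' ->]] := frac_surj w.
  rewrite fracB !HE rmorphB !rmorphM !rmorphXn exprD.
  transitivity (h g * (h f ^+ m' * e ^+ m') * e ^+ m -
     h g' * (h f ^+ m * e ^+ m) * e ^+ m'); first by ring.
  by rewrite !inv_exp !mulr1.
have HM : monoid_morphism H.
  split=> [|z w]; first by rewrite -frac10 HE rmorph1 mul1r expr0.
  have [g [m ->]] := frac_surj z; have [g' [m' ->]] := frac_surj w.
  by rewrite fracM !HE rmorphM exprD mulrACA.
pose H' : {rmorphism loc f -> S} := HB.pack H
  (GRing.isZmodMorphism.Build _ _ H HB) (GRing.isMonoidMorphism.Build _ _ H HM).
by exists H' => g; rewrite /= HE expr0 mulr1.
Qed.
End Localizations.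

Section DeltaPoints.
Variables (F : numFieldType) (p : 'I_3 -> nat).
Hypothesis hp : forall i, (1 < p i)%N.
Local Notation A := (deltaRing F p).

Definition deltaProj : {rmorphism polys F (dcoord p) -> A} := gproj (@delta_proper F p).

(** The linear function on [Delta] whose pullback is [v_{i,l+1} - v_{2,1}]. The
    coordinates [a], [b] compare the first cycles of the arms and the [gamma_{i,j}]
    consecutive cycles of one arm; [A], [B] are determined by the equations. *)
Definition shift_poly (i : 'I_3) (l : nat) : polys F (dcoord p) :=
  (if i == arm1 then - ca F p else if i == arm3 then - cb F p else 0)
  - \sum_(j < (p i).-1 | (j < l)%N) gam F j.
Definition shift i l : A := deltaProj (shift_poly i l).

Lemma pi_comorph_proj g : pi_comorph F hp (deltaProj g) = pi_poly F hp g.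
Proof. exact: glift_proj. Qed.

Lemma pi_poly_var t : pi_poly F hp (pvar F t) = pi_coord F hp t.
Proof. exact: psubst_var. Qed.

Lemma shiftS i (l : 'I_(p i).-1) : shift_poly i l.+1 = shift_poly i l - gam F l.
Proof.
rewrite /shift_poly -addrA -opprD; congr (_ - _).
rewrite (bigD1 l) //= addrC; congr (_ + _); apply: eq_bigl => j.
by rewrite ltnS [RHS]ltn_neqAle andbC.
Qed.

Lemma vv_shift i (l : 'I_(p i)) :
  vv F hp l = vv F hp (afirst hp arm2) + pi_comorph F hp (shift i l).
Proof.
rewrite /shift pi_comorph_proj; case: l => l lp /=.
elim: l lp => [|l IH] lp.
  have -> : Ordinal lp = afirst hp i by exact: val_inj.
  rewrite /shift_poly big1 ?subr0 // (fun_if (pi_poly F hp)) rmorphN /= pi_poly_var.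
  rewrite (fun_if (pi_poly F hp)) rmorphN rmorph0 /= pi_poly_var /=.
  case: (eqVneq i arm1) => [->|i1]; first by rewrite opprB addrC subrK.
  case: (eqVneq i arm3) => [->|i3]; first by rewrite opprB addrC subrK.
  have -> : i = arm2 by case: (armP i) i1 i3 => ->.
  by rewrite addr0.
have lp' : (l < (p i).-1)%N by rewrite ltn_predRL.
rewrite (shiftS (Ordinal lp')) rmorphB /= pi_poly_var /=.
have -> : low (Ordinal lp') = Ordinal (ltnW lp) by exact: val_inj.
have -> : high (Ordinal lp') = Ordinal lp by exact: val_inj.
by rewrite addrA -(IH (ltnW lp)) opprB addrC subrK.
Qed.

Definition is_delta (g : dcoord p -> F) : Prop :=
  forall e, e \in delta_eqs F p -> peval g e = 0.
Definition delta_eval g (hg : is_delta g) : {rmorphism A -> F} := glift hg.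

Lemma delta_eval_proj g (hg : is_delta g) e : delta_eval hg (deltaProj e) = peval g e.
Proof. exact: glift_proj. Qed.

(** [A] is the coordinate ring of a reduced variety: eliminating two of the
    variables makes it a polynomial ring. *)
Lemma delta_eq0 (a : A) : (forall g (hg : is_delta g), delta_eval hg a = 0) -> a = 0.
Proof.
(* Solving the two equations for [A] and [B] replaces [a] by a polynomial in the
   other coordinates, which takes the values of [a] at all points. *)
move=> a0.
pose solved (t : dcoord p) : polys F (dcoord p) :=
  if t == inr (@Ordinal 4 0 isT) then - (\sum_(j < (p arm1).-1) gam F j -
    \sum_(j < (p arm2).-1) gam F j + ca F p)
  else if t == inr (@Ordinal 4 1 isT) then - (\sum_(j < (p arm3).-1) gam F j -
    \sum_(j < (p arm2).-1) gam F j + cb F p)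
  else pvar F t.
pose S := psubst (@mpolyC #|dcoord p| F) solved.
have S_var t : S (pvar F t) = solved t by exact: psubst_var.
have S_gam i : S (\sum_(j < (p i).-1) gam F j) = \sum_(j < (p i).-1) gam F j.
  by rewrite rmorph_sum; apply: eq_bigr => j _; rewrite S_var.
have S_eqs e : e \in delta_eqs F p -> S e = 0.
  have SA : S (cA F p) = - (\sum_(j < (p arm1).-1) gam F j -
    \sum_(j < (p arm2).-1) gam F j + ca F p) by rewrite [LHS]S_var.
  have SB : S (cB F p) = - (\sum_(j < (p arm3).-1) gam F j -
    \sum_(j < (p arm2).-1) gam F j + cb F p) by rewrite [LHS]S_var.
  have Sa : S (ca F p) = ca F p by rewrite [LHS]S_var.
  have Sb : S (cb F p) = cb F p by rewrite [LHS]S_var.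
  by rewrite !inE => /orP[] /eqP ->;
    rewrite (rmorphD S (_ + _)) (rmorphD S (_ - _)) rmorphB !S_gam ?SA ?SB ?Sa ?Sb;
    ring.
have polys_ext (T : comPzRingType) (g h : {rmorphism polys F (dcoord p) -> T}) :
    (forall a, g a%:MP = h a%:MP) -> (forall t, g (pvar F t) = h (pvar F t)) -> g =1 h.
  move=> gC gX; apply: mpoly_hom_ext => // i.
  by have := gX (enum_val i); rewrite /pvar enum_valK.
have SE e : deltaProj (S e) = deltaProj e.
  apply: (polys_ext _ (deltaProj \o S) deltaProj) => [c|t] /=.
    exact: (congr1 deltaProj (mmapC _ _ c)).
  rewrite S_var /solved; case: eqP => [->|_].
    apply/eqP; rewrite -subr_eq0 -rmorphB; apply/eqP/gproj_eq0.
    exists (fun i => if i == 0%N then -1 else 0).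
    rewrite !big_ord_recl big_ord0 /= /cA; ring.
  case: eqP => [->|_ //].
  apply/eqP; rewrite -subr_eq0 -rmorphB; apply/eqP/gproj_eq0.
  exists (fun i => if i == 1%N then -1 else 0).
  by rewrite !big_ord_recl big_ord0 /= /cB; ring.
suff S0 : S (repr a) = 0 by rewrite -[a]gproj_repr -SE S0 rmorph0.
apply: mpoly_eq0_values => z.
pose ev : {rmorphism polys F (dcoord p) -> F} := mmap idfun z.
pose y t := ev (solved t).
have evS e : ev (S e) = peval y e.
  apply: (polys_ext _ (ev \o S) (peval y)) => [c|t].
    transitivity c; last by symmetry; apply: (mmapC _ idfun).
    by rewrite /= [S _]mmapC; apply: (mmapC _ idfun).
  by rewrite [LHS](congr1 ev (S_var t)) [RHS]psubst_var.
have hy : is_delta y by move=> e /S_eqs Se; rewrite -evS Se rmorph0.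
by have := a0 _ hy; rewrite -{1}[a]gproj_repr delta_eval_proj -evS.
Qed.

(** The map to [Delta] only sees differences of the cycles [v_{i,l}], so the
    common shift [t] of the cycles disappears. *)
Lemma eval_over_delta (x : arrow p -> F) (hx : is_rep x) g (hg : is_delta g) (t : F) :
  (forall i (l : 'I_(p i)), x (dn l) * x (up l) = t + delta_eval hg (shift i l)) ->
  forall a, rep_eval hp hx (inv_val (pi_comorph F hp a)) = delta_eval hg a.
Proof.
move=> xv a; rewrite -[a]gproj_repr; move: (repr a) => e.
rewrite pi_comorph_proj delta_eval_proj.
pose ev : {rmorphism inv_ring F hp -> F} :=
  rep_eval hp hx \o (val : inv_ring F hp -> repRing F hp).
have ev_v i (l : 'I_(p i)) : ev (vv F hp l) = t + delta_eval hg (shift i l).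
  by rewrite -xv [LHS](glift_proj _ hx) rmorphM !psubst_var.
apply: (mpoly_hom_ext (g := ev \o pi_poly F hp) (h := peval g)) => [c|m].
  transitivity c; last by symmetry; apply: (mmapC _ idfun).
  rewrite /= [pi_poly _ _ _]mmapC [LHS](glift_proj _ hx).
  exact: (mmapC _ idfun).
rewrite -[m]enum_valK; transitivity (ev (pi_coord F hp (enum_val m))).
  by rewrite -pi_poly_var.
transitivity (g (enum_val m)); last by symmetry; apply: psubst_var.
have g_var v : peval g (pvar F v) = g v by exact: psubst_var.
have sE i l : delta_eval hg (shift i l) = peval g (shift_poly i l).
  exact: delta_eval_proj.
have s_first i : peval g (shift_poly i (afirst hp i)) =
    if i == arm1 then - g (inr (@Ordinal 4 2 isT))
    else if i == arm3 then - g (inr (@Ordinal 4 3 isT)) else 0.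
  rewrite /shift_poly big1 ?subr0 // !(fun_if (peval g)) !rmorphN rmorph0.
  by rewrite /ca /cb !g_var.
have s_last i : peval g (shift_poly i (alast hp i)) =
    peval g (shift_poly i (afirst hp i)) - peval g (\sum_(j < (p i).-1) gam F j).
  rewrite /shift_poly [in RHS]big1 ?subr0 // rmorphB; congr (_ - peval g _).
  by apply: eq_bigl => j; rewrite ltn_ord.
have eq1 := hg _ (mem_head _ _); have eq2 := hg _ (mem_last _ _).
rewrite /= in eq1 eq2.
rewrite (rmorphD (peval g) (_ + _)) (rmorphD (peval g) (_ - _)) rmorphB in eq1.
rewrite (rmorphD (peval g) (_ + _)) (rmorphD (peval g) (_ - _)) rmorphB in eq2.
rewrite /cA /cB /ca /cb !g_var in eq1 eq2.
set gA := g _ in eq1; set gB := g _ in eq2.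
have gAE : gA = - (peval g (\sum_(j < (p arm1).-1) gam F j) -
    peval g (\sum_(j < (p arm2).-1) gam F j) + g (inr (@Ordinal 4 2 isT))).
  by rewrite -[LHS]subr0 -eq1; ring.
have gBE : gB = - (peval g (\sum_(j < (p arm3).-1) gam F j) -
    peval g (\sum_(j < (p arm2).-1) gam F j) + g (inr (@Ordinal 4 3 isT))).
  by rewrite -[LHS]subr0 -eq2; ring.
case: (enum_val m) => [[i j]|[[|[|[|[|//]]]] lt4]];
  apply: etrans (rmorphB ev _ _) _; rewrite !ev_v !sE.
- have -> : shift_poly i (high j) = shift_poly i (low j) - gam F j := shiftS j.
  have E : peval g (gam F j) = g (inl (existT _ i j)) := g_var _.
  by rewrite (rmorphB (peval g) (shift_poly i (low j)) (gam F j)) E; ring.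
- by rewrite (bool_irrelevance lt4 isT) !s_last !s_first /= -/gA gAE; ring.
- by rewrite (bool_irrelevance lt4 isT) !s_last !s_first /= -/gB gBE; ring.
- by rewrite !s_first /= (bool_irrelevance lt4 isT); ring.
- by rewrite !s_first /= (bool_irrelevance lt4 isT); ring.
Qed.
End DeltaPoints.

(** * The coordinate ring of a chart *)

Lemma mpoly_delta_eq0 (F : numFieldType) p n (q : {mpoly (deltaRing F p)[n]}) :
  (forall g (hg : is_delta g) z, mmap (delta_eval hg) z q = 0) -> q = 0.
Proof.
move=> q0; apply/mpolyP => m; rewrite mcoeff0; apply: delta_eq0 => g hg.
have : map_mpoly (delta_eval hg) q = 0.
  apply: mpoly_eq0_values => z; rewrite -[RHS](q0 g hg z).
  pose m1 : {rmorphism {mpoly F[n]} -> F} := mmap idfun z.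
  pose m2 : {rmorphism {mpoly (deltaRing F p)[n]} -> F} := mmap (delta_eval hg) z.
  apply: (mpoly_hom_ext (g := m1 \o map_mpoly (delta_eval hg)) (h := m2)) => [a|i].
    by rewrite /= map_mpolyC /m1 /m2 /= (mmapC _ idfun) mmapC.
  by rewrite /= map_mpolyX /m1 /m2 /= !mmapX.
by move/(congr1 (mcoeff m)); rewrite mcoeff0 mcoeff_map_mpoly.
Qed.

Lemma clear_scalar (R : comPzRingType) (u v f g g' : R) m N : u * v = 1 ->
  f ^+ m * (u * g' * f ^+ N - g * f ^+ N) = 0 -> f ^+ (m + N) * (g' - v * g) = 0.
Proof.
move=> uv E; transitivity (v * (f ^+ m * (u * g' * f ^+ N - g * f ^+ N))).
  rewrite exprD; transitivity (f ^+ m * f ^+ N * ((u * v) * g' - v * g)).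
    by rewrite uv mul1r.
  by ring.
by rewrite E mulr0.
Qed.

Section Chart.
Variables (F : numFieldType) (p : 'I_3 -> nat).
Hypothesis hp : forall i, (1 < p i)%N.
Variables (k o o' : 'I_3) (c : nat).
Hypotheses (ok : o != k) (o'k : o' != k) (oo' : o != o') (cp : (c < p k)%N).
Local Notation P := (polys F (arrow p)).
Local Notation var := (@pvar F (arrow p)).
Local Notation proj := (repProj F hp).
Local Notation A := (deltaRing F p).

Definition sec_poly : P := chart_section k o o' c var.

Lemma chi0E (mu : torus F p) : chi0 mu = chr mu (theta_wt p).
Proof. by apply: eq_bigr => q _; rewrite theta_wtE. Qed.

Lemma torus_act_graded mu w G : graded w G ->
  torus_act hp mu (proj G) = repC F hp (chr mu w) * proj G.
Proof. by move=> hG; rewrite act_proj (act_graded mu hG) (rmorphM proj). Qed.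

Lemma sec_semi_inv : semi_inv 2 (proj sec_poly).
Proof.
move=> mu; rewrite (torus_act_graded mu (graded_chart_section F hp k o o' c)).
by rewrite chrMn chi0E.
Qed.

Definition tree_chart : git_chart F hp := GitChart (isT : (0 < 2)%N) sec_semi_inv.
Local Notation f := (ch_sec tree_chart).
Local Notation B := (git_ring tree_chart).

Let h : {rmorphism P -> loc f} := (@loc_of _ f) \o proj.
Let X (a : arrow p) : loc f := h (var a).

Definition loc_wt (w : {ffun vertex p -> int}) (z : loc f) : Prop :=
  forall mu, @loc_act _ _ _ tree_chart mu z = loc_of f (repC F hp (chr mu w)) * z.

Lemma loc_wt_graded w G : graded w G -> loc_wt w (h G).
Proof.
move=> hG mu; rewrite [h G]/(loc_of f (proj G)) /loc_of loc_actE expr0.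
rewrite (rmorph1 (repC F hp)) mul1r.
by rewrite (torus_act_graded mu hG) fracM.
Qed.

Lemma loc_wtM w w' z z' : loc_wt w z -> loc_wt w' z' -> loc_wt (w + w') (z * z').
Proof.
move=> hz hz' mu; rewrite (loc_act_monoid tree_chart mu).2 hz hz'.
by rewrite chrD !rmorphM mulrACA.
Qed.

Lemma loc_wtV w z y : loc_wt w z -> z * y = 1 -> loc_wt (- w) y.
Proof.
move=> hz zy mu; set e := loc_of f _; set ly := loc_act mu y.
have e_inv : loc_of f (repC F hp (chr mu w)) * e = 1.
  by rewrite -!rmorphM chrN mulfV ?chr_neq0 // !rmorph1.
have : loc_act mu z * ly = 1.
  by rewrite -(loc_act_monoid tree_chart mu).2 zy (loc_act_monoid tree_chart mu).1.
rewrite hz => E; rewrite -[LHS]mul1r -e_inv -[RHS]mulr1 -E.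
transitivity (loc_of f (repC F hp (chr mu w)) * e * ly * (z * y)); last by ring.
by rewrite zy mulr1.
Qed.

Lemma loc_inv_wt0 z : loc_wt 0 z -> @is_loc_inv _ _ _ tree_chart z.
Proof. by move=> hz; apply/asboolP => mu; rewrite hz chr0 !rmorph1 mul1r. Qed.

Lemma tree_path_units : exists Y : vertex p -> loc f,
  forall q, tree_path k o c X q * Y q = 1.
Proof.
suff /choice[Y YE] : forall q, exists y, tree_path k o c X q * y = 1 by exists Y.
move=> q; have [d dE] := tree_path_dvd k o o' c X q.
exists (d * frac f 1 1); rewrite mulrA dE -(rmorph_chart_section k o o' c h var).
exact: loc_of_inv.
Qed.

Lemma other_path_unit : exists E, desc X o' (p o') * E = 1.
Proof.
have [d dE] := other_path_dvd k o o' c X.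
exists (d * frac f 1 1); rewrite mulrA dE -(rmorph_chart_section k o o' c h var).
exact: loc_of_inv.
Qed.

Lemma rel_sum : \sum_i sgn (loc f) i * desc X i (p i) = 0.
Proof.
have : h (rep_rel F p) = 0.
  rewrite [h _](_ : _ = loc_of f (proj (rep_rel F p))) //.
  rewrite (_ : proj (rep_rel F p) = 0) ?rmorph0 //.
  by apply/proj_eq0; exists 1; rewrite mul1r.
rewrite rep_relE rmorph_sum => E; rewrite -[RHS]E; apply: eq_bigr => i _.
by rewrite rmorphM rmorph_desc (rmorph_sgn h).
Qed.

Let L (i : 'I_3) (l : nat) : loc f :=
  loc_of f (inv_val (pi_comorph F hp (shift F p i l))).

Lemma cycle_shift i (l : 'I_(p i)) :
  X (dn l) * X (up l) = loc_of f (inv_val (vv F hp (afirst hp arm2))) + L i l.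
Proof.
rewrite -rmorphD -[X _ * X _]rmorphM; congr loc_of.
transitivity (inv_val (vv F hp l)); first by [].
by rewrite vv_shift.
Qed.

Section Coordinates.
Variables (Y : vertex p -> loc f) (E : loc f).
Hypothesis Y_inv : forall q, tree_path k o c X q * Y q = 1.
Hypothesis E_inv : desc X o' (p o') * E = 1.
Local Notation gauged := (gauge k o c X Y).

Lemma loc_wt_desc i : loc_wt (ind_wt bottom - ind_wt top) (desc X i (p i)).
Proof.
rewrite -[desc X _ _](rmorph_desc h var); apply: loc_wt_graded.
by have := graded_desc F (leqnn (p i)); rewrite xvert_last.
Qed.

Lemma loc_wt_tree q : loc_wt (ind_wt q - ind_wt top) (tree_path k o c X q).
Proof.
rewrite -[tree_path _ _ _ X _](rmorph_tree_path k o c h var); apply: loc_wt_graded.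
exact: graded_tree_path.
Qed.

Lemma gauged_inv a : @is_loc_inv _ _ _ tree_chart (gauged a).
Proof.
apply: loc_inv_wt0; rewrite /gauge.
have := loc_wtM (loc_wtM (loc_wt_tree (tail_of a))
  (loc_wt_graded (graded_var F a))) (loc_wtV (loc_wt_tree (head_of a)) (Y_inv _)).
by rewrite /arrow_wt [X in loc_wt (X - _)]addrC addrA subrK subrr.
Qed.

Definition delta_inv : loc f := tree_path k o c X bottom * E.

Lemma delta_inv_inv : @is_loc_inv _ _ _ tree_chart delta_inv.
Proof.
apply: loc_inv_wt0.
by have := loc_wtM (loc_wt_tree bottom) (loc_wtV (loc_wt_desc o') E_inv); rewrite subrr.
Qed.

Definition x_coord : B := GitRing (gauged_inv (dn (Ordinal cp))).
Definition y_coord : B := GitRing (gauged_inv (up (Ordinal cp))).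
Definition s_coord : B := GitRing delta_inv_inv.

Local Notation x := (gauged (dn (Ordinal cp))).
Local Notation y := (gauged (up (Ordinal cp))).

Lemma delta_invE : slice_delta p k o o' c L x y * delta_inv = 1.
Proof.
rewrite -(gauge_delta hp ok o'k oo' (cp := cp) Y_inv cycle_shift rel_sum) //.
rewrite -(gauge_other_bottom hp o'k cp Y_inv) /delta_inv.
transitivity ((tree_path k o c X bottom * Y bottom) * (desc X o' (p o') * E)).
  by ring.
by rewrite Y_inv E_inv mulr1.
Qed.

Lemma gauged_slice : gauged =1 slice k o o' c L x y delta_inv.
Proof. exact: (gauge_slice hp ok o'k oo' delta_invE Y_inv cycle_shift rel_sum). Qed.

(** Gauging multiplies a monomial by a product of powers of the tree paths that
    depends on its weight only, so for the quotient of two elements of equal weight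
    it changes nothing; and the gauged section is [slice_delta]. *)
Lemma frac_monomial (m : 'X_{1..#|arrow p|}) N : wt m = theta_wt p *+ 2 *+ N ->
  h 'X_[m] * frac f 1 1 ^+ N =
  \prod_a gauged a ^+ m (enum_rank a) * delta_inv ^+ N.
Proof.
rewrite -mulrnA => wm; rewrite (gauge_monomial Y_inv wm) exprM -mulrA -exprMn.
congr (_ * _).
  rewrite mpolyX_vars rmorph_prod (reindex _ (onW_bij _ (@enum_rank_bij (arrow p)))).
  by apply: eq_bigr => a _; rewrite rmorphXn.
congr (_ ^+ _); set e := frac f 1 1; set YY := \prod_(q | _) Y q.
have fe : h (sec_poly) * e = 1 by exact: loc_of_inv.
have YT : \prod_(q | q != top) tree_path k o c X q * YY = 1.
  by rewrite -big_split; apply: big1 => q _; apply: Y_inv.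
have := chart_section_bottom k o o' c X; rewrite -(rmorph_chart_section k o o' c h var).
rewrite -/sec_poly => fT; rewrite /delta_inv.
transitivity ((desc X o' (p o') * E) * (\prod_(q | q != top) tree_path k o c X q * YY) ^+ 2 * e).
  by rewrite E_inv YT expr1n !mul1r.
transitivity ((desc X o' (p o') * (\prod_(q | q != top) tree_path k o c X q) ^+ 2) *
  (YY ^+ 2 * E * e)); first by ring.
rewrite -fT.
transitivity ((h sec_poly * e) * (YY ^+ 2 * (tree_path k o c X bottom * E))).
  by ring.
by rewrite fe mul1r.
Qed.

Let phi : {rmorphism A -> B} := phi_comorph F hp tree_chart.

Definition chart_coord (i : 'I_3) : B :=
  if i == ord0 then x_coord else if i == ord_max then s_coord
  else y_coord.

Variable g3 : {rmorphism {mpoly A[3]} -> B}.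
Hypothesis g3C : forall a, g3 a%:MP = phi a.
Hypothesis g3X : forall i, g3 'X_i = chart_coord i.

(** The coordinates [x] and [y] are the first two variables, and [t = x y - L k c]
    is eliminated: the fibre coordinates over [Delta] are [x] and [y] alone. *)
Definition chart_delta : {mpoly A[2]} :=
  slice_delta p k o o' c (fun i l => (shift F p i l)%:MP) 'X_ord0 'X_ord_max.

Let v3 : {rmorphism {mpoly A[3]} -> loc f} := (val : B -> loc f) \o g3.

Lemma widen_delta : mwiden chart_delta =
  slice_delta p k o o' c (fun i l => (shift F p i l)%:MP) 'X_ord0 'X_(lift ord0 ord0).
Proof.
rewrite [LHS](rmorph_slice_delta p k o o' c (@mwiden 2 A)).
apply: f_equal3.
- by apply/funext => i; apply/funext => l; apply: mwidenC.
- by rewrite /= mwidenX mnmwiden1; congr 'X_[U_(_)]; apply: val_inj.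
- by rewrite /= mwidenX mnmwiden1; congr 'X_[U_(_)]; apply: val_inj.
Qed.

Lemma v3_coef a : v3 a%:MP = loc_of f (inv_val (pi_comorph F hp a)).
Proof. exact: (congr1 val (g3C a)). Qed.

Lemma v3_X i : v3 'X_i = val (chart_coord i).
Proof. exact: (congr1 val (g3X i)). Qed.

Lemma v3_delta : v3 (mwiden chart_delta) = slice_delta p k o o' c L x y.
Proof.
rewrite widen_delta (rmorph_slice_delta p k o o' c v3) !v3_X.
apply: f_equal3 => //.
by apply/funext => i; apply/funext => l; apply: v3_coef.
Qed.

Lemma v3_slice a :
  v3 (slice k o o' c (fun i l => (shift F p i l)%:MP) 'X_ord0 'X_(lift ord0 ord0)
    'X_ord_max a) = gauged a.
Proof.
rewrite (rmorph_slice k o o' c v3) gauged_slice !v3_X.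
apply: (congr1 (fun L' => slice k o o' c L' _ _ _ a)).
by apply/funext => i; apply/funext => l; apply: v3_coef.
Qed.

Lemma v3_const (a : F) : v3 (deltaProj F p a%:MP)%:MP = h a%:MP.
Proof.
rewrite v3_coef pi_comorph_proj.
by congr (loc_of f); rewrite [pi_poly _ _ _]mmapC.
Qed.

Lemma g3_inv : g3 ('X_ord_max * mwiden chart_delta) = 1.
Proof.
apply: val_inj; rewrite [LHS](rmorphM v3) v3_delta v3_X.
by rewrite mulrC; apply: delta_invE.
Qed.

(** An invariant fraction can be written with a numerator of the weight of its
    denominator, hence as a combination of the quotients of [frac_monomial]. *)
Lemma chart_surj b : exists q, g3 q = b.
Proof.
suff [q qE] : exists q, v3 q = git_val b by exists q; apply: val_inj.
have /asboolP := git_valP b; have [g [N ->]] := frac_surj (git_val b) => bE.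
(* The numerator is invariant up to the character of the denominator only after
   multiplication by a power of the section that depends on [mu]. *)
have [m E0] : exists m, proj sec_poly ^+ m *
    (proj (repr g) - proj (component (theta_wt p *+ 2 *+ N) (repr g))) = 0.
  apply: (semi_invariant_component (graded_chart_section F hp k o o' c)) => mu.
  have := bE mu; rewrite loc_actE => /frac_eq[m Em]; exists (m + N)%N.
  rewrite [proj (repr g)]gproj_repr.
  have Kc : repC F hp ((chi0 mu ^+ 2)^-1 ^+ N) * repC F hp (chr mu (theta_wt p *+ 2 *+ N)) = 1.
    by rewrite -(rmorphM (repC F hp)) chi0E !chrMn -exprMn mulVf ?expr1n
      ?rmorph1 // expf_neq0 ?chr_neq0.
  exact: (clear_scalar Kc Em).
set G := component _ _ in E0.
have gE : loc_of f g = h G.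
  apply/frac_eq; exists m; rewrite !expr0 !mulr1.
  by move: E0; rewrite [proj (repr g)]gproj_repr.
have G_wt : graded (theta_wt p *+ 2 *+ N) G.
  by apply/mpolyP => m'; rewrite !componentE; case: eqP.
rewrite frac_exp gE (mpolyE G) rmorph_sum mulr_suml big_seq.
apply: (big_ind (fun z => exists q, v3 q = z)) => [|z z' [q <-] [q' <-]|m' m'G].
- by exists 0; rewrite rmorph0.
- by exists (q + q'); rewrite rmorphD.
pose sl (a : arrow p) : {mpoly A[3]} := slice k o o' c
  (fun i l => (shift F p i l)%:MP) 'X_ord0 'X_(lift ord0 ord0) 'X_ord_max a.
exists ((deltaProj F p (G@_m')%:MP)%:MP *
  (\prod_a sl a ^+ m' (enum_rank a) * 'X_ord_max ^+ N)).
rewrite -mul_mpolyC [h _]rmorphM -mulrA (frac_monomial (gradedP G_wt m'G)).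
rewrite !rmorphM rmorphXn rmorph_prod v3_const v3_X; congr (_ * (_ * _)).
by apply: eq_bigr => a _; rewrite rmorphXn v3_slice.
Qed.

(** Each point [(g, z)] of [Delta x C^2] where [chart_delta] does not vanish is
    realized by the slice representation with these parameters. Evaluation there
    extends to the chart ring and restricts to the evaluation of polynomials on
    [A[x, y]], so a polynomial that vanishes in the chart ring vanishes at all these
    points. *)
Lemma chart_inj q : g3 (mwiden q) = 0 -> q * chart_delta = 0.
Proof.
move=> q0; apply: mpoly_delta_eq0 => g hg z.
pose ev : {rmorphism {mpoly A[2]} -> F} := mmap (delta_eval hg) z.
rewrite -[LHS]/(ev (q * chart_delta)) rmorphM.
have [->|d0] := eqVneq (ev chart_delta) 0; first by rewrite mulr0.
suff -> : ev q = 0 by rewrite mul0r.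
pose l i j := delta_eval hg (shift F p i j).
have evC a : ev a%:MP = delta_eval hg a by exact: mmapC.
have evX i : ev 'X_i = z i by rewrite /ev /= mmapX mmap1U.
have dE : ev chart_delta = slice_delta p k o o' c l (z ord0) (z ord_max).
  rewrite [LHS](rmorph_slice_delta p k o o' c ev) !evX; apply: f_equal3 => //.
  by apply/funext => i; apply/funext => j; apply: evC.
pose pt (a : arrow p) : F := slice k o o' c l (z ord0) (z ord_max) (ev chart_delta)^-1 a.
have ptX a : peval pt (var a) = pt a by exact: psubst_var.
have ptf : peval pt \o var = pt by apply/funext => a; apply: ptX.
have hpt : is_rep pt.
  move=> e; rewrite inE => /eqP ->; rewrite rep_relE rmorph_sum.
  rewrite -[RHS](slice_relation hp ok o'k oo' cp l (z ord0) (z ord_max) (ev chart_delta)^-1).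
  by apply: eq_bigr => i _; rewrite rmorphM rmorph_desc ptf rmorph_sgn.
have s_inv : slice_delta p k o o' c l (z ord0) (z ord_max) * (ev chart_delta)^-1 = 1.
  by rewrite -dE mulfV.
have ept e : rep_eval hp hpt (proj e) = peval pt e by exact: glift_proj.
have [H HE] : exists H : {rmorphism loc f -> F}, forall r, H (loc_of f r) = rep_eval hp hpt r.
  apply: (@loc_lift _ f _ (rep_eval hp hpt) (ev chart_delta)^-1).
  rewrite [rep_eval hp hpt _]ept (rmorph_chart_section k o o' c (peval pt) var) ptf.
  by rewrite slice_chart_section // s_inv.
have HX a : H (X a) = pt a by rewrite [LHS]HE ept ptX.
have Htau v : H (tree_path k o c X v) = 1.
  rewrite rmorph_tree_path (_ : H \o X = pt) ?slice_tree_path //.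
  by apply/funext => a; apply: HX.
have HY v : H (Y v) = 1.
  by have := congr1 H (Y_inv v); rewrite rmorphM Htau mul1r rmorph1.
have Hg a : H (gauged a) = pt a by rewrite /gauge !rmorphM Htau HX HY mulr1 mul1r.
have ko' : (k == o') = false by rewrite eq_sym (negPf o'k).
have -> : ev q = H (v3 (mwiden q)).
  apply: (mpoly_hom_ext (g := ev) (h := H \o v3 \o @mwiden 2 A)) => [a|i].
    rewrite evC [RHS](congr1 (H \o v3) (mwidenC _ a)) [RHS](congr1 H (v3_coef a)) HE.
    symmetry; apply: (@eval_over_delta F p hp pt hpt g hg (z ord0 * z ord_max - l k c)) => i j.
    exact: (slice_pair ok o'k oo' s_inv).
  have w3 j : widen_ord (leqnSn 2) j = (if j == ord0 then ord0 else lift ord0 ord0).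
    by apply: val_inj; case: j => [[|[|//]]].
  rewrite evX [RHS](congr1 (H \o v3) (mwidenX _ _)) mnmwiden1 w3 [RHS](congr1 H (v3_X _)).
  case: (eqVneq i ord0) => [->|i0].
    by rewrite [RHS]Hg /pt /slice /tree /= !eqxx ltnn.
  have -> : i = ord_max by apply: val_inj; case: i i0 => [[|[|//]]].
  by rewrite [RHS]Hg /pt /slice /tree /= !eqxx ltnn.
by rewrite [v3 _](congr1 val q0) rmorph0.
Qed.

End Coordinates.

Lemma tree_chart_smooth : smooth_rmorphism (phi_comorph F hp tree_chart).
Proof.
have [Y Y_inv] := tree_path_units; have [E E_inv] := other_path_unit.
have [g3 [g3C g3X]] := mpoly_hom_exists (phi_comorph F hp tree_chart)
  (chart_coord Y_inv E_inv).
apply: (smooth_localization g3C (chart_surj g3C g3X) (g3_inv g3C g3X)).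
exact: (chart_inj g3C g3X).
Qed.
End Chart.

(** * Charts at the stable points *)

Section StableLocus.
Variables (F : numFieldType) (p : 'I_3 -> nat).
Hypothesis hp : forall i, (1 < p i)%N.
Variable x : arrow p -> F.
Hypothesis x_rep : is_rep x.
Hypothesis x_stable : stable x.

(** Stability in the form in which it is used: a set of vertices that contains the
    top and is closed under nonzero arrows is everything. *)
Lemma reachable_closed (T : pred (vertex p)) : T top ->
  (forall a, x a != 0 -> T (tail_of a) -> T (head_of a)) -> forall q, T q.
Proof.
move=> Ttop Tstep q; have [s [s_path]] := x_stable q.
elim: s top Ttop s_path => [|a s IH] r Tr /=; first by move=> /eqP <-.
case/andP=> /eqP ar s_path; rewrite big_cons mulf_eq0 negb_or => /andP[xa xs].
by apply: (IH (head_of a)) => //; apply: Tstep; rewrite ?ar.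
Qed.

Lemma eval_desc i : peval x (desc (@pvar F (arrow p)) i (p i)) = desc x i (p i).
Proof. by rewrite rmorph_desc; apply: eq_bigr => l _; apply: psubst_var. Qed.

Lemma rel_values : \sum_i sgn F i * desc x i (p i) = 0.
Proof.
have := x_rep (mem_head _ _); rewrite rep_relE rmorph_sum => E; rewrite -[RHS]E.
by apply: eq_bigr => i _; rewrite rmorphM eval_desc rmorph_sgn.
Qed.

Lemma eval_chart_section k o o' c :
  rep_eval hp x_rep (ch_sec (tree_chart F hp k o o' c)) = chart_section k o o' c x.
Proof.
transitivity (peval x (sec_poly F p k o o' c)); first exact: (glift_proj _ x_rep).
rewrite (rmorph_chart_section k o o' c (peval x)).
by congr chart_section; apply/funext => a; apply: psubst_var.
Qed.

Lemma desc_neq0 i j j' : (j' <= j)%N -> desc x i j != 0 -> desc x i j' != 0.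
Proof.
move=> jj' /prodf_neq0 H; apply/prodf_neq0 => l lj'; apply: H.
exact: leq_trans jj'.
Qed.

(** Otherwise the vertices reached by descending only would be closed under the
    nonzero arrows and miss the bottom vertex. *)
Lemma some_arm_descends : exists i, desc x i (p i) != 0.
Proof.
apply/existsP; apply: contraT => /existsPn D0.
pose T (q : vertex p) := match q with
  | inl (existT i l) => desc x i l.+1 != 0 | inr is_top => is_top end.
have TE i j : (j <= p i)%N -> T (xvert p i j) = (desc x i j != 0).
  case: j => [|j] jp; first by rewrite desc0 oner_eq0.
  have [ji|ji] := ltnP j (p i).-1; first by rewrite (xvert_interior (Ordinal ji)).
  by rewrite (last_index jp ji) xvert_last // [RHS](negPf (D0 i)).
suff : T bottom by [].
apply: reachable_closed => // a; elim/arrow_ind: a => i l xa.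
  rewrite tail_dn head_dn !TE //; last exact: ltnW.
  by rewrite descS => d0; rewrite mulf_neq0.
rewrite tail_up head_up !TE //; last exact: ltnW.
exact: desc_neq0.
Qed.

(** The relation [D_1 - D_2 + D_3 = 0] forbids exactly one nonzero [D_i]. *)
Lemma two_arms_descend : exists k o o', [/\ o != k, o' != k, o != o',
  desc x o (p o) != 0 & desc x o' (p o') != 0].
Proof.
have [o Do] := some_arm_descends.
have [o' /andP[oo' Do']] : exists i, (o != i) && (desc x i (p i) != 0).
  apply/existsP; apply: contraT => /existsPn D0; move: Do.
  have := rel_values; rewrite (bigD1 o) //= big1 ?addr0 => [/eqP|i io].
    by rewrite mulf_eq0 /sgn signr_eq0 /= => ->.
  move: (D0 i); rewrite eq_sym io /= => /negPn/eqP ->.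
  by rewrite mulr0.
have [k] : exists k, (o != k) && (o' != k).
  by case: (o) (o') oo' => [[|[|[|//]]] ?] [[|[|[|//]]] ?] // _;
    first [by exists arm1 | by exists arm2 | by exists arm3].
by case/andP=> ok o'k; exists k, o, o'.
Qed.

(** Let [k] be the remaining arm and cut it at the first vanishing descending arrow,
    or at the last arrow if there is none. The vertices below the cut must then be
    reached from the bottom, so the ascending arrows below the cut do not vanish. *)
Lemma stable_in_chart : exists k o o' c, exists (ok : o != k) (o'k : o' != k)
  (oo' : o != o') (cp : (c < p k)%N), chart_section k o o' c x != 0.
Proof.
have [k [o [o' [ok o'k oo' Do Do']]]] := two_arms_descend.
pose good c := (c < p k)%N && (desc x k c != 0).
have good0 : exists c, good c.
  by exists 0%N; rewrite /good desc0 oner_eq0 ltnW.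
have good_le c : good c -> (c <= p k)%N by case/andP=> /ltnW.
have [c /andP[cp Dc] c_max] := ex_maxnP good0 good_le.
exists k, o, o', c, ok, o'k, oo', cp.
have asc0 j : (c < j)%N -> (j < p k)%N -> asc x k j != 0.
  (* If the path climbing to [x_{k,j}] vanishes, no nonzero arrow enters the set of
     vertices between the cut and the last zero arrow of that path. *)
  pose T (q : vertex p) := match q with
    | inl (existT i l) => ~~ [&& i == k, (c < l.+1)%N & asc x i l.+1 == 0]
    | inr _ => true end.
  have TE i j' : (j' <= p i)%N -> T (xvert p i j') =
      ~~ [&& i == k, (c < j')%N, (j' < p i)%N & asc x i j' == 0].
    case: j' => [|j'] jp; first by rewrite ltn0 andbF.
    have [ji|ji] := ltnP j' (p i).-1.
      by rewrite (xvert_interior (Ordinal ji)) /= -ltn_predRL ji.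
    by rewrite (last_index jp ji) xvert_last // ltnn !andbF.
  move=> cj jp; have : T (xvert p k j).
    apply: reachable_closed => // a; elim/arrow_ind: a => i l xa.
      rewrite tail_dn head_dn !TE //; last exact: ltnW.
      apply: contra => /and4P[ik cl lp /eqP a0].
      rewrite ik ltn_ord ascS a0 mulr0 eqxx !andbT /=.
      move: cl; rewrite ltnS leq_eqVlt => /orP[/eqP cl|//].
      move: l xa cl lp a0 => /=; rewrite (eqP ik) => l xa cl lp _.
      have : good l.+1 by rewrite /good lp descS -cl mulf_neq0.
      by move/c_max; rewrite cl ltnn.
    rewrite tail_up head_up !TE //; last exact: ltnW.
    apply: contra => /and4P[ik cl lp]; rewrite ascS mulf_eq0 (negPf xa) /= => a0.
    rewrite ik a0 andbT (ltn_trans cl) //=.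
    move: a0; rewrite ltn_neqAle ltn_ord andbT; apply: contraL => /eqP ->.
    by rewrite asc_last oner_eq0.
  by rewrite TE ?(ltnW jp) // eqxx cj jp.
rewrite /chart_section mulf_neq0 ?expf_neq0 ?(mulf_neq0 Do' Do) //.
apply/prodf_neq0 => -[[i l]|[]] //= _.
have lp : (l.+1 < p i)%N by rewrite -ltn_predRL.
have [ik|ik] := eqVneq i k.
  move: l lp; rewrite ik => l lp /=; case: ltnP => cl.
    by rewrite mulf_neq0 // asc0.
  exact: desc_neq0 Dc.
rewrite /=; apply: (@desc_neq0 i (p i)); first exact: ltnW.
have [->//|io] := eqVneq i o; by rewrite (is_other_arm ok o'k oo' ik io).
Qed.
End StableLocus.

(** * Generators of the invariant ring *)

Section WeightZero.
Variables (p : 'I_3 -> nat).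
Hypothesis hp : forall i, (1 < p i)%N.

Lemma big_arrows (R : Type) (idx : R) (op : Monoid.com_law idx) (f : arrow p -> R) :
  \big[op/idx]_a f a = \big[op/idx]_i \big[op/idx]_(l < p i) op (f (dn l)) (f (up l)).
Proof.
pose g (s : {i : 'I_3 & 'I_(p i)}) b := f (s, b).
rewrite (eq_bigr (fun a : arrow p => g a.1 a.2)); last by case.
rewrite -(pair_bigA _ g) (eq_bigr (fun s => op (g s true) (g s false))); last first.
  by move=> s _; rewrite -big_bool; apply: eq_bigl.
by rewrite sig_big_dep /=; apply: eq_bigr => -[i l] _.
Qed.

Variable m : arrow p -> nat.
Hypothesis m_wt0 : \sum_a arrow_wt a *+ m a = 0.

(** The number of times a circulation with multiplicities [m] descends the [l]-th
    place of arm [i], counted with sign. *)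
Definition net (i : 'I_3) (l : 'I_(p i)) : int := (m (dn l))%:Z - (m (up l))%:Z.

Lemma net_at q :
  \sum_i \sum_(l < p i) ((xvert p i l.+1 == q)%:Z - (xvert p i l == q)%:Z) * net l = 0.
Proof.
have := congr1 (fun w : {ffun vertex p -> int} => w q) m_wt0.
rewrite /= ffunE => E; rewrite -[RHS]E sum_ffunE big_arrows.
apply: eq_bigr => i _; apply: eq_bigr => l _.
rewrite !ffunMnE !ffunE head_dn tail_dn head_up tail_up /net.
rewrite -[_ *+ m (dn l)]mulr_natr -[_ *+ m (up l)]mulr_natr !natz.
by rewrite [q == xvert _ _ l]eq_sym [q == xvert _ _ _.+1]eq_sym /=; ring.
Qed.

Lemma xvert_eq_top i j : (xvert p i j == top) = (j == 0)%N.
Proof. by case: j => [|j]; rewrite ?eqxx // /xvert; case: insubP. Qed.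

Lemma xvert_eq_interior i j i' j' : (j <= p i)%N -> (0 < j' < p i')%N ->
  (xvert p i j == xvert p i' j') = (i == i') && (j == j').
Proof.
pose pos (q : vertex p) : option ('I_3 * nat) :=
  if q is inl (existT i l) then Some (i, l.+1) else None.
have pos_xvert i1 j1 : (0 < j1 < p i1)%N -> pos (xvert p i1 j1) = Some (i1, j1).
  by case: j1 => [//|j1] jp; rewrite (xvert_interior (Ordinal (_ : (j1 < (p i1).-1)%N)))
    ?ltn_predRL.
move=> jp jp'; apply/eqP/andP => [E|[/eqP -> /eqP -> //]].
have := pos_xvert _ _ jp'; rewrite -E.
have [-> //|j0] := posnP j; have [pj|pj] := ltnP j (p i).
  by rewrite pos_xvert ?j0 // => -[-> ->].
have -> : j = p i by apply/eqP; rewrite eqn_leq jp.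
by rewrite xvert_last.
Qed.

(** Conservation of the flow at the interior vertices of arm [i]. *)
Lemma net_const i (l : 'I_(p i)) : net l = net (afirst hp i).
Proof.
case: l => l lp; elim: l lp => [|l IH] lp; first by congr net; apply: val_inj.
rewrite -(IH (ltnW lp)); apply/eqP; rewrite eq_sym -subr_eq0; apply/eqP.
rewrite -[RHS](net_at (xvert p i l.+1)) (bigD1 i) //=.
have at_i i' j : (j <= p i')%N ->
    (xvert p i' j == xvert p i l.+1) = (i' == i) && (j == l.+1).
  by move=> jp; apply: xvert_eq_interior.
rewrite [X in _ = _ + X]big1 => [|i' /negPf ii']; last first.
  rewrite big1 // => l' _; rewrite (at_i i' l') ?(at_i i' l'.+1) ?ii' ?subrr ?mul0r //.
  exact: ltnW.
rewrite addr0 (bigD1 (Ordinal lp)) //= (bigD1 (Ordinal (ltnW lp))) /=; last first.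
  by rewrite -val_eqE /= neq_ltn ltnSn.
rewrite big1 => [|l']; last first.
  rewrite -!val_eqE /= => /andP[/negPf l1 /negPf l2].
  rewrite (at_i i l') ?(at_i i l'.+1) ?eqSS ?l1 ?l2 ?andbF ?subrr ?mul0r //.
  exact: ltnW.
rewrite (at_i i l.+2) // (at_i i l.+1) ?(ltnW lp) // (at_i i l) ?(ltnW (ltnW lp)) //.
by rewrite !eqxx !eqSS (gtn_eqF (ltnSn l)) (ltn_eqF (ltnSn l)) /=; ring.
Qed.

(** Conservation of the flow at the top vertex. *)
Lemma net_sum0 : \sum_i net (afirst hp i) = 0.
Proof.
apply/eqP; rewrite -oppr_eq0 -sumrN; apply/eqP; rewrite -[RHS](net_at top).
apply: eq_bigr => i _; rewrite (bigD1 (afirst hp i)) //= big1 ?addr0.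
  by rewrite !xvert_eq_top /= sub0r mulN1r.
move=> l l0; rewrite !xvert_eq_top /= [_ == 0%N](_ : _ = false) ?subrr ?mul0r //.
by apply: contraNF l0 => /eqP l0; apply/eqP/val_inj.
Qed.

(** A monomial of weight 0 is a circulation on the quiver. Once the 2-cycles
    [d_{ij} u_{ij}] are split off, each arm is run either only down or only up, and
    as often at each place of the arm; the balance at the top vertex makes the
    descents as many as the ascents. *)
Lemma circulation (S : comPzRingType) (X : arrow p -> S) :
  exists (e : {i : 'I_3 & 'I_(p i)} -> nat) (a b : 'I_3 -> nat),
  (\sum_i a i = \sum_i b i)%N /\
  \prod_s X s ^+ m s = (\prod_i \prod_(l < p i) (X (dn l) * X (up l)) ^+ e (Tagged _ l)) *
    ((\prod_i desc X i (p i) ^+ a i) * (\prod_i asc X i 0 ^+ b i)).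
Proof.
(* At most one of [a i], [b i] is nonzero, by truncated subtraction. *)
pose e (s : {i : 'I_3 & 'I_(p i)}) := minn (m (s, true)) (m (s, false)).
pose a i := (m (dn (afirst hp i)) - m (up (afirst hp i)))%N.
pose b i := (m (up (afirst hp i)) - m (dn (afirst hp i)))%N.
exists e, a, b; split.
  apply/eqP; rewrite -eqz_nat -!natz !natr_sum -subr_eq0 -sumrB.
  rewrite -[X in _ == X]net_sum0; apply/eqP/eq_bigr => i _; rewrite !natz /a /b /net.
  set x := m _; set y := m _; case: (leqP x y) => xy.
    by rewrite -(subzn xy) (_ : x - y = 0)%N ?sub0r ?opprB //; apply/eqP.
  rewrite -(subzn (ltnW xy)) (_ : y - x = 0)%N ?subr0 //.
  by apply/eqP; rewrite subn_eq0 ltnW.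
have mE i (l : 'I_(p i)) : m (dn l) = (e (Tagged _ l) + a i)%N /\
    m (up l) = (e (Tagged _ l) + b i)%N.
  have : (m (dn l) + m (up (afirst hp i)) = m (dn (afirst hp i)) + m (up l))%N.
    apply/eqP; rewrite -eqz_nat !PoszD; apply/eqP.
    have := net_const l; rewrite /net => E.
    transitivity ((m (dn l))%:Z - (m (up l))%:Z + (m (up l))%:Z + (m (up (afirst hp i)))%:Z).
      by ring.
    by rewrite E; ring.
  rewrite /e /a /b /dn /up; lia.
rewrite big_arrows -!big_split; apply: eq_bigr => i _ /=.
rewrite desc_all asc0 -!prodrXl -!big_split; apply: eq_bigr => l _ /=.
have [-> ->] := mE i l; rewrite !exprD exprMn; ring.
Qed.
End WeightZero.

Section Invariants.
Variables (F : numFieldType) (p : 'I_3 -> nat).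
Hypothesis hp : forall i, (1 < p i)%N.
Local Notation P := (polys F (arrow p)).
Local Notation var := (@pvar F (arrow p)).
Local Notation proj := (repProj F hp).
Local Notation B := (inv_ring F hp).

Lemma graded0_inv G : graded 0 G -> is_inv (proj G).
Proof.
by move=> hG; apply/asboolP => mu; rewrite act_proj (act_graded mu hG) chr0 mpolyC1 mul1r.
Qed.

Lemma graded_cycle i j : graded 0 (desc var i (p i) * asc var j 0).
Proof.
have := gradedM (graded_desc F (leqnn (p i))) (graded_asc F hp (leq0n (p j))).
by rewrite xvert_last // addrC addrA subrK subrr.
Qed.

Definition cyc i j : B := InvRing (graded0_inv (graded_cycle i j)).

Lemma cycM i j i' j' : cyc i j * cyc i' j' = cyc i j' * cyc i' j.
Proof.
by apply: val_inj; rewrite !rmorphM /= -!rmorphM; congr (proj _); ring.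
Qed.

Lemma cyc_diag i : cyc i i = \prod_(l < p i) vv F hp l.
Proof.
apply: val_inj; rewrite rmorph_prod /= /v_rep -rmorph_prod; congr (proj _).
by rewrite desc_all asc0 -big_split.
Qed.

Lemma cyc_rel j : cyc arm1 j - cyc arm2 j + cyc arm3 j = 0.
Proof.
apply: val_inj; rewrite rmorphD rmorphB /= -rmorphB -rmorphD -mulrBl -mulrDl.
rewrite rmorphM -!/(Dpath F p _) (_ : proj (_ - _ + _) = 0) ?mul0r //.
by apply/proj_eq0; exists 1; rewrite mul1r /rep_rel /Dpath !desc_all.
Qed.

(** An invariant is the image of its component of weight 0, whose monomials are
    circulations; pairing the descents with the ascents in any way writes them as
    products of cycles. *)
Lemma inv_generated (Q : B -> Prop) :
  (forall a : F, Q (invC_val hp a)) -> (forall i (l : 'I_(p i)), Q (vv F hp l)) ->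
  (forall i j, Q (cyc i j)) ->
  (forall b b', Q b -> Q b' -> Q (b + b')) -> (forall b b', Q b -> Q b' -> Q (b * b')) ->
  forall b, Q b.
Proof.
move=> QC Qv Qc QD QM b.
have Q1 : Q 1 by have := QC 1; rewrite (_ : invC_val hp 1 = 1) //; apply: val_inj; apply: rmorph1.
have QX b0 n : Q b0 -> Q (b0 ^+ n).
  by move=> Qb; elim: n => [|n IH]; rewrite ?expr0 // exprS; apply: (QM).
have Qprod (J : finType) (f : J -> B) : (forall j, Q (f j)) -> Q (\prod_j f j).
  by move=> Qf; apply: (big_ind Q) => // *; apply: (QM).
pose QR r := exists b, inv_val b = r /\ Q b.
have QR_cyc (s1 s2 : seq 'I_3) : size s1 = size s2 ->
    QR (proj ((\prod_(i <- s1) desc var i (p i)) * (\prod_(i <- s2) asc var i 0))).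
  elim: s1 s2 => [|i s1 IH] [|j s2] //= => [_|[/IH[b0 [b0E Qb]]]].
    by exists 1; rewrite !big_nil mulr1 rmorph1.
  exists (cyc i j * b0); split; last exact: QM.
  by rewrite !big_cons mulrACA rmorphM -b0E.
pose G := component 0 (repr (inv_val b)).
have bE : inv_val b = proj G.
  have [m] : exists m, proj 1 ^+ m * (proj (repr (inv_val b)) - proj G) = 0.
    apply: (semi_invariant_component (@graded1 F p)) => mu; exists 0%N.
    rewrite expr0 mul1r [proj (repr _)]gproj_repr chr0 rmorph1 mul1r.
    by have /asboolP -> := inv_valP b; rewrite subrr.
  rewrite rmorph1 expr1n mul1r [proj (repr _)]gproj_repr => /eqP.
  by rewrite subr_eq0 => /eqP.
have G_wt : graded 0 G by apply/mpolyP => m'; rewrite !componentE; case: eqP.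
suff [b' [b'E Qb]] : QR (proj G) by rewrite (_ : b = b') //; apply: val_inj; apply: etrans bE (esym b'E).
rewrite (mpolyE G) rmorph_sum big_seq.
apply: (big_ind QR) => [|r r' [b1 [<- Q1b]] [b2 [<- Q2b]]|m mG].
- exists 0; split=> //; have := QC 0; rewrite (_ : invC_val hp 0 = 0) //.
  by apply: val_inj; apply: rmorph0.
- by exists (b1 + b2); split=> //; apply: QD.
have m_wt := gradedP G_wt mG.
have [e [a [b0 [ab mE]]]] := circulation hp m_wt var.
pose rep_seq (n : 'I_3 -> nat) := flatten [seq nseq (n i) i | i <- enum 'I_3].
have size_rep n : size (rep_seq n) = (\sum_i n i)%N.
  rewrite size_flatten /shape -map_comp sumnE big_map big_enum.
  by apply: eq_bigr => i _; rewrite /= size_nseq.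
have prod_rep n (D : 'I_3 -> P) : \prod_(i <- rep_seq n) D i = \prod_i D i ^+ n i.
  rewrite big_flatten big_map big_enum; apply: eq_bigr => i _.
  elim: (n i) => [|k IH]; first by rewrite big_nil expr0.
  by rewrite big_cons IH exprS.
have := QR_cyc (rep_seq a) (rep_seq b0); rewrite !size_rep !prod_rep => /(_ ab)[c [cE Qcc]].
exists (invC_val hp G@_m *
  ((\prod_i \prod_(l < p i) vv F hp l ^+ e (Tagged _ l)) * c)); split; last first.
  by apply: (QM) => //; apply: (QM) => //; apply: (Qprod) => i; apply: (Qprod) => l; apply: QX.
pose vR : {rmorphism B -> repRing F hp} := (val : B -> repRing F hp).
have VE : vR (\prod_i \prod_(l < p i) vv F hp l ^+ e (Tagged _ l)) =
    proj (\prod_i \prod_(l < p i) (var (dn l) * var (up l)) ^+ e (Tagged _ l)).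
  rewrite (rmorph_prod vR) (rmorph_prod proj); apply: eq_bigr => i _.
  rewrite (rmorph_prod vR) (rmorph_prod proj); apply: eq_bigr => l _.
  by rewrite (rmorphXn vR) (rmorphXn proj).
have XE : 'X_[m] = \prod_a var a ^+ m (enum_rank a).
  by rewrite mpolyX_vars (reindex _ (onW_bij _ (@enum_rank_bij (arrow p)))).
rewrite -mul_mpolyC XE mE (rmorphM proj) (rmorphM proj) -cE -VE.
by rewrite [LHS](rmorphM vR) (rmorphM vR).
Qed.
End Invariants.

(** * A basis of the invariants over the functions on Delta *)

Section EvaluationAt.
Variables (R S : comNzRingType) (f : {rmorphism R -> S}) (z : S).

Fact eval_comm : commr_rmorph f z. Proof. by move=> a; apply: mulrC. Qed.
Definition poly_at : {rmorphism {poly R} -> S} := horner_morph eval_comm.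

Lemma poly_atC a : poly_at a%:P = f a. Proof. exact: horner_morphC. Qed.
Lemma poly_atX : poly_at 'X = z. Proof. exact: horner_morphX. Qed.
Lemma poly_atE q : poly_at q = \sum_(i < size q) f q`_i * z ^+ i.
Proof.
rewrite -{1}[q]coefK poly_def rmorph_sum; apply: eq_bigr => i _.
by rewrite -mul_polyC rmorphM rmorphXn poly_atX poly_atC.
Qed.
End EvaluationAt.

Section PartialFractions.
Variable F : numFieldType.

(** [X^(size q)] times the principal part [b / X * q(b / X)]. *)
Definition polar_part (q : {poly F}) (b : F) : {poly F} :=
  \sum_(k < size q) (q`_k * b ^+ k.+1) *: 'X^(size q - k.+1).

Lemma polar_partE q b s : s != 0 ->
  (polar_part q b).[s] = s ^+ size q * (b / s * q.[b / s]).
Proof.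
move=> s0; rewrite horner_sum [q.[_]]horner_coef !mulr_sumr; apply: eq_bigr => k _.
rewrite hornerZ hornerXn.
have -> : s ^+ size q = s ^+ (size q - k.+1) * s ^+ k.+1 by rewrite -exprD subnK.
rewrite [b / s * _]mulrCA -exprS exprMn exprVn.
transitivity (q`_k * b ^+ k.+1 * s ^+ (size q - k.+1) * (s ^+ k.+1 * (s ^+ k.+1)^-1)).
  by rewrite mulfV ?mulr1 // expf_neq0.
by ring.
Qed.

(** The value at 0 is the leading coefficient of [q] up to a power of [b]. *)
Lemma polar_part0 q b : b != 0 -> (polar_part q b).[0] = 0 -> q = 0.
Proof.
move=> b0; have [/eqP|q0] := posnP (size q); first by rewrite size_poly_eq0 => /eqP.
rewrite horner_sum /polar_part; case E : (size q) q0 => [//|n] _.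
rewrite big_ord_recr big1 /= => [|k _].
  rewrite add0r subnn hornerZ hornerXn expr0 mulr1 => /eqP.
  rewrite mulf_eq0 expf_eq0 (negPf b0) andbF orbF.
  by rewrite (_ : q`_n = lead_coef q) ?lead_coef_eq0 => [/eqP|]; rewrite // /lead_coef E.
by rewrite hornerZ hornerXn expr0n subn_eq0 ltnNge ltn_ord mulr0.
Qed.

(** Uniqueness of partial fractions with poles at infinity, 0 and 1: after clearing
    denominators, the values at 0 and 1 see only the leading coefficients of the
    principal parts. *)
Lemma partial_fractions_unique (a b c : F) (q1 q2 q3 : {poly F}) :
  a != 0 -> b != 0 -> c != 0 ->
  (forall s, s != 0 -> 1 - s != 0 ->
    q1.[a * s] + b / s * q2.[b / s] + c / (1 - s) * q3.[c / (1 - s)] = 0) ->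
  [/\ q1 = 0, q2 = 0 & q3 = 0].
Proof.
move=> a0 b0 c0 H.
(* The sum multiplied by the two denominators. *)
pose T := (q1 \Po (a *: 'X)) * 'X^(size q2) * (1 - 'X) ^+ size q3 +
  polar_part q2 b * (1 - 'X) ^+ size q3 + (polar_part q3 c \Po (1 - 'X)) * 'X^(size q2).
have TE s : T.[s] = q1.[a * s] * s ^+ size q2 * (1 - s) ^+ size q3 +
    (polar_part q2 b).[s] * (1 - s) ^+ size q3 + (polar_part q3 c).[1 - s] * s ^+ size q2.
  by rewrite /T !(hornerD, hornerM, horner_exp, horner_comp, hornerXn, hornerZ, hornerN, hornerC, hornerX).
have T0 : T = 0.
  apply: (@poly_eq0_values _ _ [:: 0; 1]) => s; rewrite !inE negb_or => /andP[s0 s1].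
  have s1' : 1 - s != 0 by rewrite subr_eq0 eq_sym.
  rewrite TE !polar_partE //.
  transitivity (s ^+ size q2 * (1 - s) ^+ size q3 * (q1.[a * s] + b / s * q2.[b / s] +
    c / (1 - s) * q3.[c / (1 - s)])); last by rewrite H // mulr0.
  by ring.
have q20 : q2 = 0.
  apply/eqP; rewrite -size_poly_eq0; apply: contraT => n0.
  rewrite -(negPf n0) size_poly_eq0; apply/eqP/(polar_part0 b0).
  have := TE 0; rewrite T0 horner0 expr0n (negPf n0) subr0 expr1n !mulr0 mul0r.
  by rewrite add0r addr0 mulr1 => <-.
have q30 : q3 = 0.
  apply/eqP; rewrite -size_poly_eq0; apply: contraT => n0.
  rewrite -(negPf n0) size_poly_eq0; apply/eqP/(polar_part0 c0).
  have := TE 1; rewrite T0 horner0 subrr expr0n (negPf n0) !mulr0 !add0r expr1n.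
  by rewrite mulr1 => <-.
split=> //; apply: (@poly_eq0_values _ _ [:: 0; a]) => z.
rewrite !inE negb_or => /andP[z0 za].
have za0 : z / a != 0 by rewrite mulf_neq0 ?invr_eq0.
have za1 : 1 - z / a != 0.
  by rewrite subr_eq0 eq_sym -(inj_eq (mulIf a0)) divfK // mul1r.
by have := H _ za0 za1; rewrite q20 q30 !horner0 !mulr0 !addr0 mulrCA mulfV ?mulr1.
Qed.
End PartialFractions.

Section Basis.
Variables (F : numFieldType) (p : 'I_3 -> nat).
Hypothesis hp : forall i, (1 < p i)%N.
Local Notation A := (deltaRing F p).
Local Notation B := (inv_ring F hp).
Local Notation phi := (pi_comorph F hp).

Definition base_param : B := vv F hp (afirst hp arm2).
(** All [v_{i,j}] differ from [t = v_{2,1}] by functions on [Delta], so they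
    generate an image of the polynomial ring [A[t]] in the invariant ring. *)
Definition rho : {rmorphism {poly A} -> B} := poly_at phi base_param.

(** The generators [w_1 = D_1 U_2], [w_2 = D_2 U_1], [w_3 = - D_2 U_3]. *)
Definition ww (i : 'I_3) : B :=
  if i == arm1 then cyc F hp arm1 arm2
  else if i == arm2 then cyc F hp arm2 arm1 else - cyc F hp arm2 arm3.

Definition head_w (i : 'I_3) : B := if i == arm1 then 1 else ww i.

(** With [head_w] the three polynomials give the terms [w_1^n] for [n >= 0] and
    [w_2^n], [w_3^n] for [n > 0], so that 1 is counted once. *)
Definition w_span (f : 'I_3 -> {poly {poly A}}) : B :=
  \sum_i head_w i * poly_at rho (ww i) (f i).

Definition spanned (b : B) : Prop := exists f, b = w_span f.

Definition arm_poly (i : 'I_3) : {poly A} := \prod_(l < p i) ('X + (shift F p i l)%:P).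

Lemma rho_v i (l : 'I_(p i)) : rho ('X + (shift F p i l)%:P) = vv F hp l.
Proof. by rewrite rmorphD /= poly_atX poly_atC vv_shift. Qed.

Lemma rho_arm i : rho (arm_poly i) = cyc F hp i i.
Proof. by rewrite cyc_diag rmorph_prod; apply: eq_bigr => l _; apply: rho_v. Qed.

(** The rows [(D_i U_j)_j] have rank one, and the relation expresses the third row
    by the other two. The mixed products are therefore linear in the [w_i]:
    [w_1 w_2 = P_1 P_2], [w_1 w_3 = P_2 w_3 + P_2 P_3], [w_2 w_3 = P_1 w_3 - P_3 w_2],
    where [P_i = D_i U_i] is the product of the [v_{i,j}]. *)
Lemma w_reduce i j : i != j -> exists a b c : {poly A},
  ww i * ww j = rho a * ww i + rho b * ww j + rho c.
Proof.
have rel k := cyc_rel F hp k.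
have id13 (R : comPzRingType) (p2 p3 c13 c23 : R) : c13 - c23 + p3 = 0 ->
    - (c13 * p2) = p2 * - c23 + p2 * p3.
  move=> E; transitivity (p2 * - c23 + p2 * p3 - p2 * (c13 - c23 + p3)); first by ring.
  by rewrite E mulr0 subr0.
have id23 (R : comPzRingType) (p1 p3 c21 c23 c31 : R) :
    p1 - c21 + c31 = 0 -> c23 * c31 = c21 * p3 ->
    c21 * - c23 = p1 * - c23 - p3 * c21.
  move=> E E'; transitivity (p1 * - c23 - p3 * c21 + c23 * (p1 - c21 + c31)
    - (c23 * c31 - c21 * p3)); first by ring.
  by rewrite E E' subrr mulr0 subr0 addr0.
pose P i := cyc F hp i i.
have w12 : ww arm1 * ww arm2 = P arm1 * P arm2 by rewrite /ww /= cycM.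
have w13 : ww arm1 * ww arm3 = P arm2 * ww arm3 + P arm2 * P arm3.
  rewrite /ww /= mulrN cycM -/(P arm2); apply: id13; exact: rel.
have w23 : ww arm2 * ww arm3 = P arm1 * ww arm3 - P arm3 * ww arm2.
  by rewrite /ww /=; apply: id23 (rel arm1) _; rewrite cycM.
have up a b c k l : ww k * ww l = rho a * ww k + rho b * ww l + rho c ->
  exists a b c : {poly A}, ww l * ww k = rho a * ww l + rho b * ww k + rho c.
  by move=> E; exists b, a, c; rewrite mulrC E; congr (_ + _); rewrite addrC.
have r12 : ww arm1 * ww arm2 = rho 0 * ww arm1 + rho 0 * ww arm2 +
    rho (arm_poly arm1 * arm_poly arm2).
  by rewrite w12 rmorph0 rmorphM !rho_arm !mul0r !add0r.
have r13 : ww arm1 * ww arm3 = rho 0 * ww arm1 + rho (arm_poly arm2) * ww arm3 +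
    rho (arm_poly arm2 * arm_poly arm3).
  by rewrite w13 rmorph0 rmorphM !rho_arm mul0r add0r.
have r23 : ww arm2 * ww arm3 = rho (- arm_poly arm3) * ww arm2 +
    rho (arm_poly arm1) * ww arm3 + rho 0.
  by rewrite w23 rmorph0 rmorphN !rho_arm mulNr addr0 addrC.
case: (armP i) => ->; case: (armP j) => -> // _.
- by do 3!eexists; exact: r12.
- by do 3!eexists; exact: r13.
- exact: up r12.
- by do 3!eexists; exact: r23.
- exact: up r13.
- exact: up r23.
Qed.

Lemma spanned_single j q : spanned (head_w j * poly_at rho (ww j) q).
Proof.
exists (fun i => if i == j then q else 0); rewrite /w_span (bigD1 j) //= eqxx.
by rewrite big1 ?addr0 // => i /negPf ->; rewrite rmorph0 mulr0.
Qed.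

Lemma spanned_exp j n : spanned (ww j ^+ n).
Proof.
case: n => [|n].
  by have := spanned_single arm1 1; rewrite rmorph1 mulr1 expr0.
have [j1|j1] := eqVneq j arm1.
  have := spanned_single j 'X^(n.+1).
  by rewrite rmorphXn /= poly_atX /head_w j1 mul1r.
have := spanned_single j 'X^n.
by rewrite rmorphXn /= poly_atX /head_w (negPf j1) -exprS.
Qed.

Lemma spannedD b b' : spanned b -> spanned b' -> spanned (b + b').
Proof.
move=> [f ->] [f' ->]; exists (fun i => f i + f' i); rewrite -big_split.
by apply: eq_bigr => i _; rewrite rmorphD mulrDr.
Qed.

Lemma span_scale s f : w_span (fun i => s%:P * f i) = rho s * w_span f.
Proof.
rewrite /w_span mulr_sumr; apply: eq_bigr => i _.
by rewrite rmorphM /= poly_atC mulrCA.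
Qed.

Lemma spanned_scale s b : spanned b -> spanned (rho s * b).
Proof. by move=> [f ->]; rewrite -span_scale; eexists. Qed.

Lemma spanned_sum (J : finType) (f : J -> B) :
  (forall j, spanned (f j)) -> spanned (\sum_j f j).
Proof.
move=> Hf; apply: (big_ind spanned) => //; last exact: spannedD.
by exists (fun=> 0); rewrite /w_span big1 // => i _; rewrite rmorph0 mulr0.
Qed.

Lemma stable_span z : (forall j n, spanned (z * ww j ^+ n)) ->
  forall b, spanned b -> spanned (z * b).
Proof.
move=> Hz b [f ->]; rewrite /w_span mulr_sumr; apply: spanned_sum => i.
rewrite poly_atE !mulr_sumr; apply: spanned_sum => n.
rewrite [head_w i * _]mulrCA [z * _]mulrCA; apply: spanned_scale.
rewrite /head_w; case: ifP => _; first by rewrite mul1r.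
by rewrite -exprS.
Qed.

(** By [w_reduce], multiplying [w_j^n] by another [w_i] lowers the exponent of the
    mixed term until none is left. *)
Lemma spanned_mulw i b : spanned b -> spanned (ww i * b).
Proof.
apply: stable_span => j n; have [->|ij] := eqVneq i j.
  by rewrite -exprS; apply: spanned_exp.
have [a [b' [c E]]] := w_reduce ij.
elim: n => [|n IH]; first by rewrite expr0 mulr1 -[ww i]expr1; apply: spanned_exp.
rewrite exprS mulrA E !mulrDl -!mulrA -exprS.
apply: spannedD; last exact/spanned_scale/spanned_exp.
by apply: spannedD; apply: spanned_scale => //; apply: spanned_exp.
Qed.

(** The elements that preserve the span by multiplication form a subring; it
    contains the generators. *)
Lemma all_spanned b : spanned b.
Proof.
pose Q b := forall b', spanned b' -> spanned (b * b').
suff Qb : Q b by rewrite -[b]mulr1; apply: Qb; rewrite -(expr0 (ww arm1)); apply: spanned_exp.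
have Qrho s : Q (rho s) by move=> b'; apply: spanned_scale.
have Qw i : Q (ww i) by move=> b'; apply: spanned_mulw.
have QD b1 b2 : Q b1 -> Q b2 -> Q (b1 + b2).
  by move=> Q1 Q2 b' Sb'; rewrite mulrDl; apply: spannedD; [apply: Q1|apply: Q2].
have QM b1 b2 : Q b1 -> Q b2 -> Q (b1 * b2).
  by move=> Q1 Q2 b' Sb'; rewrite -mulrA; apply/Q1/Q2.
have QN b1 : Q b1 -> Q (- b1).
  by move=> Q1; rewrite -mulN1r -(rmorph1 rho) -rmorphN; apply: QM.
have Qc_diag i : Q (cyc F hp i i) by rewrite -rho_arm.
have rel j := cyc_rel F hp j.
have Q12 : Q (cyc F hp arm1 arm2) by exact: (Qw arm1).
have Q21 : Q (cyc F hp arm2 arm1) by exact: (Qw arm2).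
have Q23 : Q (cyc F hp arm2 arm3) by rewrite -[cyc _ _ _ _]opprK; exact: QN (Qw arm3).
apply: (inv_generated (Q := Q)) => //.
- move=> a; have Ea : rho (deltaProj F p a%:MP)%:P = invC_val hp a.
    by rewrite /rho poly_atC pi_comorph_proj [pi_poly _ _ _]mmapC.
  rewrite -Ea. exact: Qrho.
- by move=> i l; have := Qrho ('X + (shift F p i l)%:P); rewrite rho_v.
have rel_solve (R : comPzRingType) (x y z : R) : x - y + z = 0 ->
    z = y - x /\ x = y - z.
  move=> E; split; first by rewrite -[RHS]addr0 -E; ring.
  by rewrite -[RHS]addr0 -E; ring.
move=> i j; case: (armP i) => ->; case: (armP j) => -> //.
- by rewrite (rel_solve _ _ _ _ (rel arm3)).2; apply: QD => //; apply: QN.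
- by rewrite (rel_solve _ _ _ _ (rel arm1)).1; apply: QD => //; apply: QN.
- by rewrite (rel_solve _ _ _ _ (rel arm2)).1; apply: QD => //; apply: QN.
Qed.

Section Points.
Variables (g : dcoord p -> F) (hg : is_delta g) (t s : F).
Hypotheses (s0 : s != 0) (s1 : 1 - s != 0).

Definition cycle_val i (l : nat) : F := t + delta_eval hg (shift F p i l).
Definition arm_val (i : 'I_3) : F :=
  if i == arm1 then s else if i == arm2 then 1 else 1 - s.
(** A representation with [D_1 = s], [D_2 = 1], [D_3 = 1 - s] over the point [g], all
    of whose cycles are prescribed. It gives [w_1], [w_2], [w_3] the values [s V_2],
    [V_1 / s] and [- V_3 / (1 - s)], with [V_i] the product of the cycles of arm [i]. *)
Definition line_pt (a : arrow p) : F :=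
  let: (existT i l, down) := a in
  let d := if l == 0 :> nat then arm_val i else 1 in
  if down then d else cycle_val i l / d.

Definition cycle_prod i : F := \prod_(l < p i) cycle_val i l.

Lemma arm_val_neq0 i : arm_val i != 0.
Proof. by rewrite /arm_val; case: ifP => // _; case: ifP => // _; apply: oner_neq0. Qed.

Lemma line_pt_cycle i (l : 'I_(p i)) : line_pt (dn l) * line_pt (up l) = cycle_val i l.
Proof.
by rewrite /= mulrCA mulfV ?mulr1 //; case: ifP; rewrite ?arm_val_neq0 ?oner_neq0.
Qed.

Lemma line_pt_desc i : desc line_pt i (p i) = arm_val i.
Proof.
rewrite desc_all (bigD1 (afirst hp i)) //= big1 ?mulr1 // => l l0.
by rewrite ifF //; apply: contraNF l0 => /eqP l0; apply/eqP/val_inj.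
Qed.

Lemma line_pt_asc i : asc line_pt i 0 = cycle_prod i / arm_val i.
Proof.
rewrite -[LHS](mulKf (arm_val_neq0 i)) mulrC; congr (_ / _).
rewrite -{1}(line_pt_desc i) desc_all asc0 -big_split.
by apply: eq_bigr => l _; apply: line_pt_cycle.
Qed.

Lemma line_pt_rep : is_rep line_pt.
Proof.
move=> e; rewrite inE => /eqP ->; rewrite /rep_rel /Dpath -!desc_all rmorphD rmorphB.
rewrite !eval_desc !line_pt_desc /arm_val /=; ring.
Qed.

Definition line_eval : {rmorphism B -> F} :=
  rep_eval hp line_pt_rep \o (val : B -> repRing F hp).

Lemma line_eval_proj b e : inv_val b = repProj F hp e -> line_eval b = peval line_pt e.
Proof. by move=> bE; rewrite /line_eval /= [val b]bE; apply: (glift_proj _ line_pt_rep). Qed.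

Lemma line_eval_cyc i j : line_eval (cyc F hp i j) = arm_val i * (cycle_prod j / arm_val j).
Proof.
rewrite (@line_eval_proj _ (desc (@pvar F (arrow p)) i (p i) * asc (@pvar F _) j 0)) //.
rewrite rmorphM eval_desc line_pt_desc rmorph_asc -line_pt_asc; congr (_ * _).
by apply: eq_bigr => l _; apply: psubst_var.
Qed.

Lemma line_eval_phi a : line_eval (phi a) = delta_eval hg a.
Proof. exact: (@eval_over_delta F p hp line_pt line_pt_rep g hg t line_pt_cycle). Qed.

Lemma line_eval_base : line_eval base_param = t.
Proof.
rewrite (@line_eval_proj _ (pvar F (dn (afirst hp arm2)) * pvar F (up (afirst hp arm2)))) //.
rewrite rmorphM !psubst_var line_pt_cycle /cycle_val.
have -> : shift F p arm2 (afirst hp arm2) = 0.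
  by rewrite /shift /shift_poly big1 // subr0 rmorph0.
by rewrite rmorph0 addr0.
Qed.

Definition fiber_eval : {rmorphism {poly A} -> F} := poly_at (delta_eval hg) t.

Lemma line_eval_rho q : line_eval (rho q) = fiber_eval q.
Proof.
rewrite /rho /fiber_eval !poly_atE rmorph_sum; apply: eq_bigr => i _.
by rewrite rmorphM rmorphXn line_eval_base [line_eval _]line_eval_phi.
Qed.

Lemma line_eval_at z q :
  line_eval (poly_at rho z q) = (map_poly fiber_eval q).[line_eval z].
Proof.
rewrite -[RHS]/(poly_at fiber_eval (line_eval z) q) !poly_atE rmorph_sum.
by apply: eq_bigr => i _; rewrite rmorphM rmorphXn [line_eval (rho _)]line_eval_rho.
Qed.
End Points.

(** At the points [line_pt] over a fixed [g] and with a fixed shift [t], a vanishing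
    combination becomes a vanishing sum of partial fractions in [s]. Hence its
    coefficients vanish at [(g, t)] for all but finitely many [t], and for all [g]. *)
Lemma span_inj0 f : w_span f = 0 -> forall i, f i = 0.
Proof.
move=> f0; suff fib0 g (hg : is_delta g) t : (forall i, cycle_prod hg t i != 0) ->
    forall i, map_poly (fiber_eval hg t) (f i) = 0.
  move=> i; apply/polyP => n; rewrite coef0; apply/polyP => m; rewrite coef0.
  apply: delta_eq0 => g hg.
  suff : map_poly (delta_eval hg) (f i)`_n = 0.
    by move/(congr1 (fun q : {poly F} => q`_m)); rewrite coef_map coef0.
  (* The values of [t] at which some cycle vanishes are excluded, since the [V_i]
     must be nonzero for the powers of the [w_i] to be independent. *)
  pose bad := [seq - delta_eval hg (shift F p j l) | j <- enum 'I_3, l <- iota 0 (p j)].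
  apply: (@poly_eq0_values _ _ bad) => t t_bad.
  rewrite -[_.[t]]/(fiber_eval hg t (f i)`_n).
  have V0 j : cycle_prod hg t j != 0.
    apply/prodf_neq0 => l _; apply: contra t_bad.
    rewrite /cycle_val addr_eq0 => /eqP ->.
    by apply/allpairsPdep; exists j, (l : nat); rewrite mem_enum mem_iota /=.
  by move/(congr1 (fun q : {poly F} => q`_n)): (fib0 g hg t V0 i); rewrite coef_map coef0.
move=> V0; have V i := V0 i.
have [] := @partial_fractions_unique F (cycle_prod hg t arm2) (cycle_prod hg t arm1)
  (- cycle_prod hg t arm3) (map_poly (fiber_eval hg t) (f arm1))
  (map_poly (fiber_eval hg t) (f arm2)) (map_poly (fiber_eval hg t) (f arm3));
  rewrite ?oppr_eq0 //.
  move=> s s0 s1; have := congr1 (line_eval hg t s) f0.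
  rewrite rmorph0 => E; rewrite -[RHS]E rmorph_sum sum_arm123.
  have W1 : line_eval hg t s (ww arm1) = cycle_prod hg t arm2 * s.
    by rewrite [LHS](line_eval_cyc hg t s0 s1) /arm_val /= divr1 mulrC.
  have W2 : line_eval hg t s (ww arm2) = cycle_prod hg t arm1 / s.
    by rewrite [LHS](line_eval_cyc hg t s0 s1) /arm_val /= mul1r.
  have W3 : line_eval hg t s (ww arm3) = - cycle_prod hg t arm3 / (1 - s).
    rewrite [ww arm3]/(- cyc F hp arm2 arm3) rmorphN (line_eval_cyc hg t s0 s1).
    by rewrite /arm_val /= mul1r mulNr.
  have [H1 H2 H3] : [/\ head_w arm1 = 1, head_w arm2 = ww arm2 & head_w arm3 = ww arm3].
    by [].
  by rewrite H1 H2 H3 mul1r !rmorphM !(line_eval_at hg t s0 s1) W1 W2 W3.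
by move=> f1 f2 f3 i; case: (armP i) => ->.
Qed.

Lemma span_inj f f' : w_span f = w_span f' -> forall i, f i = f' i.
Proof.
move=> E i; apply/eqP; rewrite -subr_eq0; apply/eqP.
apply: (@span_inj0 (fun i => f i - f' i)).
transitivity (w_span f - w_span f'); last by rewrite E subrr.
by rewrite -sumrB; apply: eq_bigr => j _; rewrite rmorphB mulrBr.
Qed.

(** The elements [t^m w_i^n] form a basis of the invariant ring. *)
Lemma pi_flat : flat_rmorphism phi.
Proof.
have [cf cfE] := choice all_spanned.
pose e (j : 'I_3 * (nat * nat)) : B := head_w j.1 * (base_param ^+ j.2.2 * ww j.1 ^+ j.2.1).
pose coord (j : 'I_3 * (nat * nat)) b : A := (cf b j.1)`_j.2.1`_j.2.2.
apply: (@flat_basis _ _ _ _ e coord) => [j b b'|j a b|b].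
- have E : w_span (cf (b + b')) = w_span (fun i => cf b i + cf b' i).
    rewrite -cfE {1}(cfE b) {1}(cfE b') -big_split.
    by apply: eq_bigr => i _; rewrite rmorphD mulrDr.
  by rewrite /coord (span_inj E) !coefD.
- have E : w_span (cf (phi a * b)) = w_span (fun i => a%:P%:P * cf b i).
    by rewrite -cfE span_scale -cfE /rho poly_atC.
  by rewrite /coord (span_inj E) !coefCM.
pose degs i : seq (nat * nat) :=
  [seq (n, m) | n <- iota 0 (size (cf b i)), m <- iota 0 (size (cf b i)`_n)].
exists [seq (i, nm) | i <- enum 'I_3, nm <- degs i]; split.
- apply: allpairs_uniq_dep => [||[i nm] [i' nm'] _ _ [-> ->] //]; first exact: enum_uniq.
  move=> i _; apply: allpairs_uniq_dep => [||[n m] [n' m'] _ _ [-> ->] //].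
    exact: iota_uniq.
  by move=> n _; apply: iota_uniq.
- move=> [i [n m]] inm; rewrite /coord /=; have [nl|nl] := ltnP n (size (cf b i)).
    rewrite nth_default // leqNgt; apply: contra inm => ml.
    apply/allpairsPdep; exists i, (n, m); rewrite mem_enum; split=> //.
    by apply/allpairsPdep; exists n, m; rewrite !mem_iota.
  by rewrite [(cf b i)`_n]nth_default // coef0.
have iotaE n : iota 0 n = index_iota 0 n by rewrite /index_iota subn0.
rewrite big_allpairs_dep big_enum {1}(cfE b); apply: eq_bigr => i _.
rewrite big_allpairs_dep /coord /e /= poly_atE mulr_sumr.
rewrite iotaE big_mkord; apply: eq_bigr => n _.
rewrite iotaE big_mkord /rho poly_atE mulr_suml mulr_sumr.
by apply: eq_bigr => m _; rewrite [RHS]mulrCA !mulrA.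
Qed.
End Basis.

Theorem theorem1p1 (K : realType) (p : 'I_3 -> nat) (hp : forall i : 'I_3, (2 <= p i)%N) :
  smooth_morphism (phi_comorph K[i] hp) /\
  flat_rmorphism (pi_comorph K[i] hp).
Proof.
split; last exact: (@pi_flat K[i] p hp).
move=> x; have [k [o [o' [c [ok [o'k [oo' [cp sec0]]]]]]]] :=
  stable_in_chart (F := K[i]) hp (rep_valP x) (rep_stable x).
exists (tree_chart K[i] hp k o o' c); split; last exact: tree_chart_smooth.
by move: sec0; rewrite -(eval_chart_section hp (rep_valP x)).
Qed.
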